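(* Let $a,b,c,d,e,f,g$ be nonzero complex numbers with $a=bc$, let $z=de/q$, and suppose $\left|\frac{aq}{fg}\right|<1$. Then $$ {}_{6}\psi_{6}\left[z;b,c,\tfrac{fz}{a},\tfrac{gz}{a};q,\tfrac{aq}{fg}\right] =\frac{\left(q,\;de,\;\frac{q^2}{de},\;\frac{de}{bc},\;\frac{cq}{f},\;\frac{cq}{g},\;\frac{bq}{f},\;\frac{bq}{g},\;\frac{(bcq)^2}{defg};q\right)_\infty}{\left(\frac qb,\;\frac qc,\;\frac{aq}{f},\;\frac{aq}{g},\;\frac{de}{b},\;\frac{de}{c},\;\frac{aq}{fg},\;\frac{aq^2}{def},\;\frac{aq^2}{deg};q\right)_\infty}. $$
   Context: Fix a complex number $q$ with $0<|q|<1$. Set $(x;q)_\infty=\prod_{n\ge 0}(1-xq^n)$, $(x;q)_n=(x;q)_\infty/(xq^n;q)_\infty$ for every integer $n$ (positive, zero or negative), and $(x_1,\dots,x_m;q)_n=\prod_i (x_i;q)_n$ (also for $n=\infty$). Very-well-poised bilateral series: ${}_6\psi_6[a;a_3,\dots,a_6;q,Z]=\sum_{n=-\infty}^{\infty}\frac{1-aq^{2n}}{1-a}\prod_{i=3}^{6}\frac{(a_i;q)_n}{(aq/a_i;q)_n}\,Z^n$. Convention: parameters are such that no denominator appearing (in the product or in terms of the series) vanishes. *)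

(* Defs.v *)
From Stdlib Require Import Reals ZArith List.
From Coquelicot Require Import Coquelicot.
Import ListNotations.
Open Scope C_scope.

Definition Cprod (l : list C) : C := fold_right Cmult 1 l.

Definition Cpowz (x : C) (n : Z) : C :=
  match n with
  | Z0 => 1
  | Zpos p => x ^ Pos.to_nat p
  | Zneg p => / x ^ Pos.to_nat p
  end.

Fixpoint qprod (q x : C) (n : nat) : C :=
  match n with
  | O => 1
  | S m => qprod q x m * (1 - x * q ^ m)
  end.

(* [iota] picks the limit of the partial products, which exists for |q| < 1;
   see [iota_filterlim_locally]. *)
Definition qpoch_inf (q x : C) : C :=
  iota (T := C_CompleteNormedModule)
    (fun l : C => filterlim (qprod q x) eventually (locally l)).

Definition qpochs_inf (q : C) (xs : list C) : C :=
  Cprod (map (qpoch_inf q) xs).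

(* (x;q)_n = (x;q)_oo / (x q^n;q)_oo.  When x is a power of q both infinite
   products may vanish; the 0/0 quotient is then read in the usual way, after
   cancelling the common factors: as the product of the 1 - x q^i for
   0 <= i < n if n >= 0, and as the inverse of the product of the 1 - x q^i for
   n <= i < 0 if n < 0. *)
Definition qpoch (q x : C) (n : Z) : C :=
  if Ceq_dec (qpoch_inf q (x * Cpowz q n)) 0 then
    match n with
    | Z0 => 1
    | Zpos p => qprod q x (Pos.to_nat p)
    | Zneg p => / qprod q (x * Cpowz q n) (Pos.to_nat p)
    end
  else qpoch_inf q x / qpoch_inf q (x * Cpowz q n).

(* A series over Z converges when both of its halves, over n >= 0 and over
   n < 0, converge. *)
Definition is_bilateral_series (u : Z -> C) (l : C) : Prop :=
  exists lp ln : C,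
    is_series (K := C_AbsRing) (V := C_NormedModule)
      (fun n : nat => u (Z.of_nat n)) lp /\
    is_series (K := C_AbsRing) (V := C_NormedModule)
      (fun n : nat => u (- Z.of_nat (S n))%Z) ln /\
    l = lp + ln.

Definition vwp_term (q a : C) (xs : list C) (t : C) (n : Z) : C :=
  (1 - a * Cpowz q (2 * n)) / (1 - a)
  * Cprod (map (fun x => qpoch q x n / qpoch q (a * q / x) n) xs)
  * Cpowz t n.

(* "The series 6psi6[a; a3, a4, a5, a6; q, t] converges, with sum l." *)
Definition is_psi66 (q a a3 a4 a5 a6 t l : C) : Prop :=
  is_bilateral_series (vwp_term q a [a3; a4; a5; a6] t) l.

(* Main.v *)
Require Import Defs.
From Stdlib Require Import Reals ZArith List.
From Coquelicot Require Import Coquelicot.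
From Stdlib Require Import Lra Lia FunctionalExtensionality.
Import ListNotations.
Open Scope C_scope.

(** Write the four parameters as [1 / u_i].  A telescoping identity shows that
    the series [S(u1,u2,u3,u)], multiplied by
    [(1 - z q u)(1 - q u)(1 - q z^2 u1 u2 u3 u)], equals [S(u1,u2,u3,q u)]
    multiplied by [(1 - z q u1 u)(1 - z q u2 u)(1 - z q u3 u)].  Iterating, and
    letting [u q^N] tend to 0 under the sum by dominated convergence, expresses
    [S(u1,u2,u3,u)] through [S(u1,u2,u3,0)]; doing this for each parameter
    reduces the series to [S(0,0,0,0)].  That sum is found by running the same
    reduction on [S(1/z,1,0,0)], of which only the term [n = 0] survives.  This
    fails when [z] is a power of [q]; there [S(0,0,0,0)] vanishes by the
    functional equation of the theta function. *)

(** * Limits and series of complex numbers *)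

(** Telescoping a one-sided series leaves a boundary term at [n = 0]. The bilateral series is
    handled as two one-sided series with bases [z] and [1 / z], and only their combination, with the
    doubly counted central term removed, satisfies a homogeneous relation. The passage to the limit
    needs a geometric majorant independent of [N]. Since a [u_i] may be 0, [|u_i|] itself cannot
    serve as its ratio: each is enlarged to some [M_i > 0], the overall ratio staying below 1.
    Limits are taken in identities cleared of denominators, so products over pairs of parameters may
    vanish. The exceptional powers of [q] come from [S(1/z,1,0,0)]: its parameters [z] and [1] bring
    [(q/z;q)_oo] and [(zq;q)_oo] into the denominators. Since [(1 - z) S(0,0,0,0)] is the bilateral
    theta series, evaluating it amounts to proving Jacobi's triple product. *)

(** Stated through real distances, so that the limit laws for real sequences apply; [clim_filterlim]
    links it to the filters behind [qpoch_inf] and [is_series]. *)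
Definition clim (u : nat -> C) (l : C) : Prop :=
  is_lim_seq (fun n => Cmod (u n - l)) 0%R.

Lemma clim_filterlim (u : nat -> C) (l : C) :
  clim u l <->
  filterlim u eventually (locally (T := C_CompleteNormedModule) l).
Proof.
  unfold clim; split; intros H.
  - apply (proj2 (filterlim_locally_ball_norm (U := C_NormedModule) u l)).
    intros eps.
    destruct (proj2 (is_lim_seq_spec _ _) H eps) as [N HN].
    exists N; intros n Hn; specialize (HN n Hn); simpl in HN.
    rewrite Rminus_0_r, Rabs_pos_eq in HN by apply Cmod_ge_0.
    exact HN.
  - apply is_lim_seq_spec; intros eps.
    destruct (proj1 (filterlim_locally_ball_norm (U := C_NormedModule) u l) H eps)
      as [N HN].
    exists N; intros n Hn; specialize (HN n Hn).
    rewrite Rminus_0_r, Rabs_pos_eq by apply Cmod_ge_0.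
    exact HN.
Qed.

Lemma clim_unique (u : nat -> C) (l m : C) : clim u l -> clim u m -> l = m.
Proof.
  rewrite !clim_filterlim; intros H1 H2.
  exact (filterlim_locally_unique (V := C_CompleteNormedModule) u l m H1 H2).
Qed.

Lemma clim_ext (u v : nat -> C) (l : C) :
  (forall n, u n = v n) -> clim u l -> clim v l.
Proof.
  intros E; apply is_lim_seq_ext; intros n; now rewrite E.
Qed.

Lemma clim_const (c : C) : clim (fun _ => c) c.
Proof.
  unfold clim; apply is_lim_seq_ext with (fun _ => 0%R).
  - intros _; replace (c - c) with (RtoC 0) by ring; now rewrite Cmod_0.
  - apply is_lim_seq_const.
Qed.

Lemma clim_le (u : nat -> C) (l : C) (v : nat -> R) :
  (forall n, (Cmod (u n - l) <= v n)%R) -> is_lim_seq v 0%R -> clim u l.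
Proof.
  intros Hle Hv; unfold clim.
  apply is_lim_seq_le_le with (fun _ => 0%R) v; try easy.
  - intros n; split; [apply Cmod_ge_0 | apply Hle].
  - apply is_lim_seq_const.
Qed.

Lemma clim_plus (u v : nat -> C) (l m : C) :
  clim u l -> clim v m -> clim (fun n => u n + v n) (l + m).
Proof.
  intros Hu Hv.
  apply clim_le with (fun n => (Cmod (u n - l) + Cmod (v n - m))%R).
  - intros n; replace (u n + v n - (l + m)) with ((u n - l) + (v n - m)) by ring.
    apply Cmod_triangle.
  - replace 0%R with (0 + 0)%R by ring; now apply is_lim_seq_plus'.
Qed.

Lemma clim_mult (u v : nat -> C) (l m : C) :
  clim u l -> clim v m -> clim (fun n => u n * v n) (l * m).
Proof.
  intros Hu Hv.
  apply clim_le with (fun n => (Cmod (u n - l) * Cmod (v n - m)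
    + (Cmod (u n - l) * Cmod m + Cmod l * Cmod (v n - m)))%R).
  - intros n.
    replace (u n * v n - l * m) with
      ((u n - l) * (v n - m) + ((u n - l) * m + l * (v n - m))) by ring.
    rewrite <- !Cmod_mult.
    eapply Rle_trans; [apply Cmod_triangle |].
    apply Rplus_le_compat_l, Cmod_triangle.
  - replace 0%R with (0 * 0 + (0 * Cmod m + Cmod l * 0))%R by ring.
    apply is_lim_seq_plus'; [| apply is_lim_seq_plus']; apply is_lim_seq_mult';
      assumption || apply is_lim_seq_const.
Qed.

Lemma clim_scal (c : C) (u : nat -> C) (l : C) :
  clim u l -> clim (fun n => c * u n) (c * l).
Proof. apply clim_mult, clim_const. Qed.

Lemma clim_minus (u v : nat -> C) (l m : C) :
  clim u l -> clim v m -> clim (fun n => u n - v n) (l - m).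
Proof.
  intros Hu Hv.
  apply clim_ext with (fun n => u n + (-(1)) * v n); [intros n; ring |].
  replace (l - m) with (l + (-(1)) * m) by ring.
  now apply clim_plus, clim_scal.
Qed.

Lemma clim_Cmod (u : nat -> C) (l : C) :
  clim u l -> is_lim_seq (fun n => Cmod (u n)) (Cmod l).
Proof.
  intros Hu.
  apply is_lim_seq_le_le with (fun n => (Cmod l - Cmod (u n - l))%R)
    (fun n => (Cmod l + Cmod (u n - l))%R).
  - intros n; split.
    + replace l with (u n + (l - u n)) at 1 by ring.
      pose proof (Cmod_triangle (u n) (l - u n)) as H.
      replace (u n - l) with (- (l - u n)) by ring; rewrite Cmod_opp; lra.
    + replace (u n) with (l + (u n - l)) at 1 by ring.
      apply Cmod_triangle.
  - replace (Finite (Cmod l)) with (Finite (Cmod l - 0)) by (f_equal; ring).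
    apply is_lim_seq_minus'; [apply is_lim_seq_const | easy].
  - replace (Finite (Cmod l)) with (Finite (Cmod l + 0)) by (f_equal; ring).
    apply is_lim_seq_plus'; [apply is_lim_seq_const | easy].
Qed.

Lemma clim_inv (u : nat -> C) (l : C) :
  (forall n, u n <> 0) -> l <> 0 -> clim u l -> clim (fun n => / u n) (/ l).
Proof.
  intros Hn Hl Hu; unfold clim.
  apply is_lim_seq_ext with
    (fun n => (Cmod (u n - l) / (Cmod (u n) * Cmod l))%R).
  - intros n.
    replace (/ u n - / l) with (- ((u n - l) / (u n * l)))
      by (field; auto).
    rewrite Cmod_opp, Cmod_div, Cmod_mult; auto using Cmult_neq_0.
  - pose proof (proj1 (Cmod_gt_0 l) Hl).
    replace (Finite 0) with (Finite (0 / (Cmod l * Cmod l)))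
      by (f_equal; field; lra).
    apply is_lim_seq_div'; [easy | | nra].
    apply is_lim_seq_mult'; [now apply clim_Cmod | apply is_lim_seq_const].
Qed.

Lemma clim_subseq (u : nat -> C) (l : C) (phi : nat -> nat) :
  (forall n, (phi n < phi (S n))%nat) -> clim u l -> clim (fun n => u (phi n)) l.
Proof.
  intros Hphi Hu; unfold clim.
  exact (is_lim_seq_subseq (fun n => Cmod (u n - l)) _ phi
           (eventually_subseq phi Hphi) Hu).
Qed.

Lemma clim_pow (q : C) : (Cmod q < 1)%R -> clim (fun n => q ^ n) 0.
Proof.
  intros Hq.
  apply clim_le with (fun n => (Cmod q ^ n)%R).
  - intros n; replace (q ^ n - 0) with (q ^ n) by ring.
    rewrite Cmod_pow; apply Rle_refl.
  - apply is_lim_seq_geom; rewrite Rabs_pos_eq; auto using Cmod_ge_0.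
Qed.

(** * Complex series and dominated convergence *)

Definition is_cseries (f : nat -> C) (l : C) : Prop :=
  is_series (K := C_AbsRing) (V := C_NormedModule) f l.

Definition csum (f : nat -> C) (n : nat) : C :=
  sum_n (G := C_NormedModule) f n.

Definition cseries (f : nat -> C) : C :=
  iota (T := C_CompleteNormedModule) (fun l => is_cseries f l).

Lemma csum_O (f : nat -> C) : csum f 0 = f 0%nat.
Proof. exact (sum_O (G := C_NormedModule) f). Qed.

Lemma csum_S (f : nat -> C) (n : nat) : csum f (S n) = csum f n + f (S n).
Proof. exact (sum_Sn (G := C_NormedModule) f n). Qed.

Lemma is_cseries_clim (f : nat -> C) (l : C) : is_cseries f l <-> clim (csum f) l.
Proof. symmetry; apply clim_filterlim. Qed.

Lemma cseries_unique (f : nat -> C) (l : C) : is_cseries f l -> cseries f = l.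
Proof.
  exact (iota_filterlim_locally (V := C_CompleteNormedModule) (F := eventually)
           (csum f) l).
Qed.

Lemma is_lim_seq_geom_tail (A r : R) : (0 <= r < 1)%R ->
  is_lim_seq (fun K => A * r ^ S K / (1 - r))%R 0%R.
Proof.
  intros Hr.
  apply is_lim_seq_ext with (fun K => (A * r / (1 - r)) * r ^ K)%R.
  - intros n; simpl; field; lra.
  - replace (Finite 0) with (Finite ((A * r / (1 - r)) * 0)) by (f_equal; ring).
    apply is_lim_seq_mult'; [apply is_lim_seq_const |].
    apply is_lim_seq_geom; rewrite Rabs_pos_eq; lra.
Qed.

Section GeometricDomination.

Variables (f : nat -> C) (A r : R).
Hypothesis Hr : (0 <= r < 1)%R.
Hypothesis Hf : forall n, (Cmod (f n) <= A * r ^ n)%R.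

Lemma geom_cseries : is_cseries f (cseries f).
Proof.
  assert (H : ex_series (V := C_CompleteNormedModule) f).
  { apply (ex_series_le (V := C_CompleteNormedModule) f (fun n => A * r ^ n)%R).
    - exact Hf.
    - apply (ex_series_scal (V := R_NormedModule) A (fun n => r ^ n)%R).
      apply ex_series_geom; rewrite Rabs_pos_eq; lra. }
  destruct H as [l Hl].
  rewrite (cseries_unique f l Hl); exact Hl.
Qed.

(** The factor [1 - r ^ m] of the finite geometric sum is kept so that the induction on [m]
    closes. *)
Lemma geom_csum_tail (K m : nat) :
  (Cmod (csum f (K + m) - csum f K) <= A * r ^ S K * (1 - r ^ m) / (1 - r))%R.
Proof.
  induction m as [|m IH].
  - rewrite Nat.add_0_r; replace (csum f K - csum f K) with (RtoC 0) by ring.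
    rewrite Cmod_0; simpl; right; field; lra.
  - rewrite Nat.add_succ_r, csum_S.
    replace (csum f (K + m) + f (S (K + m)) - csum f K)
      with ((csum f (K + m) - csum f K) + f (S (K + m))) by ring.
    eapply Rle_trans; [apply Cmod_triangle |].
    eapply Rle_trans; [apply Rplus_le_compat; [apply IH | apply Hf] |].
    right; replace (S (K + m)) with (S K + m)%nat by lia.
    rewrite pow_add; simpl; field; lra.
Qed.

Lemma geom_cseries_tail (K : nat) :
  (Cmod (cseries f - csum f K) <= A * r ^ S K / (1 - r))%R.
Proof.
  assert (HA : (0 <= A)%R).
  { pose proof (Hf 0) as H0; pose proof (Cmod_ge_0 (f 0)); simpl in H0; lra. }
  assert (Hl : clim (fun m => csum f (K + m) - csum f K) (cseries f - csum f K)).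
  { apply clim_minus; [| apply clim_const].
    apply (clim_subseq (csum f)); [intros; lia |].
    apply is_cseries_clim, geom_cseries. }
  apply clim_Cmod in Hl.
  apply (is_lim_seq_le _ (fun _ => A * r ^ S K / (1 - r))%R _
    (A * r ^ S K / (1 - r))%R) with (2 := Hl); [| apply is_lim_seq_const].
  intros m; eapply Rle_trans; [apply geom_csum_tail |].
  assert (H1 : (0 <= r ^ S K)%R) by (apply pow_le; lra).
  assert (H2 : (0 <= r ^ m)%R) by (apply pow_le; lra).
  unfold Rdiv; apply Rmult_le_compat_r.
  - left; apply Rinv_0_lt_compat; lra.
  - assert (0 <= A * r ^ S K)%R by now apply Rmult_le_pos.
    nra.
Qed.

End GeometricDomination.

(** Tannery's theorem, by thirds of [eps]: past a common [K] the tails are small uniformly in [N],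
    and the initial segment is a finite sum, where the limit is taken termwise. *)
Lemma cseries_tannery (F : nat -> nat -> C) (f : nat -> C) (A r : R) :
  (0 <= r < 1)%R ->
  (forall N n, (Cmod (F N n) <= A * r ^ n)%R) ->
  (forall n, clim (fun N => F N n) (f n)) ->
  clim (fun N => cseries (F N)) (cseries f).
Proof.
  intros Hr HF Hlim.
  assert (Hf : forall n, (Cmod (f n) <= A * r ^ n)%R).
  { intros n.
    apply (is_lim_seq_le (fun N => Cmod (F N n)) (fun _ => A * r ^ n)%R
             (Cmod (f n)) (A * r ^ n)%R); [intros N; apply HF | |].
    - apply clim_Cmod, Hlim.
    - apply is_lim_seq_const. }
  assert (Hs : forall K, clim (fun N => csum (F N) K) (csum f K)).
  { induction K as [|K IH].
    - apply clim_ext with (fun N => F N 0%nat);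
        [intros N; now rewrite csum_O | rewrite csum_O; apply Hlim].
    - apply clim_ext with (fun N => csum (F N) K + F N (S K));
        [intros N; now rewrite csum_S | rewrite csum_S].
      now apply clim_plus. }
  apply is_lim_seq_spec; intros eps.
  assert (He : (0 < eps / 3)%R) by (destruct eps; simpl; lra).
  destruct (proj2 (is_lim_seq_spec _ _) (is_lim_seq_geom_tail A r Hr)
              (mkposreal _ He)) as [K HK].
  specialize (HK K (Nat.le_refl K)).
  destruct (proj2 (is_lim_seq_spec _ _) (Hs K) (mkposreal _ He)) as [N0 HN0].
  exists N0; intros N HN; specialize (HN0 N HN).
  rewrite Rminus_0_r in HK, HN0 |- *.
  change (pos (mkposreal _ He)) with (eps / 3)%R in HK, HN0.
  rewrite Rabs_pos_eq in HN0 |- * by apply Cmod_ge_0.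
  pose proof (Rle_abs (A * r ^ S K / (1 - r))%R) as H0.
  pose proof (geom_cseries_tail (F N) A r Hr (HF N) K) as H1.
  pose proof (geom_cseries_tail f A r Hr Hf K) as H2.
  replace (cseries (F N) - cseries f) with
    ((cseries (F N) - csum (F N) K) + ((csum (F N) K - csum f K)
      + - (cseries f - csum f K))) by ring.
  pose proof (Cmod_triangle (cseries (F N) - csum (F N) K)
    ((csum (F N) K - csum f K) + - (cseries f - csum f K))) as T1.
  pose proof (Cmod_triangle (csum (F N) K - csum f K)
    (- (cseries f - csum f K))) as T2.
  rewrite Cmod_opp in T2.
  lra.
Qed.

(** * Infinite q-products *)

Lemma Cinv_0 : / (0 : C) = 0.
Proof. unfold Cinv; simpl; unfold RtoC; f_equal; unfold Rdiv; ring. Qed.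

Lemma Cinv_neq_0 (x : C) : x <> 0 -> / x <> 0.
Proof. intros Hx E. apply C1_nz. rewrite <- (Cinv_r x Hx), E. ring. Qed.

Lemma Cmult_eq_reg_r (z x y : C) : x * z = y * z -> z <> 0 -> x = y.
Proof.
  intros H Hz; replace x with (x * z * / z) by (field; exact Hz).
  rewrite H; field; exact Hz.
Qed.

Section NonzeroBase.

Variable q : C.
Hypothesis hq0 : q <> 0.
Hypothesis hq1 : (Cmod q < 1)%R.

Lemma Cmod_q_pos : (0 < Cmod q)%R.
Proof. now apply Cmod_gt_0. Qed.

Lemma qprod_S_l (x : C) (n : nat) : qprod q x (S n) = (1 - x) * qprod q (x * q) n.
Proof.
  induction n as [|n IH]; [simpl; ring |].
  change (qprod q x (S (S n))) with (qprod q x (S n) * (1 - x * q ^ S n)).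
  rewrite IH; simpl; ring.
Qed.

Lemma qprod_add (x : C) (m n : nat) :
  qprod q x (m + n) = qprod q x m * qprod q (x * q ^ m) n.
Proof.
  induction n as [|n IH].
  - rewrite Nat.add_0_r; simpl; ring.
  - rewrite Nat.add_succ_r; simpl; rewrite IH, Cpow_add_r; ring.
Qed.

(** From [1 + t <= exp t] and the geometric sum of the [B * |q|^n]. The abstract [P] serves both the
    q-products and the numerators of [hprod]. *)
Lemma Rprod_exp_bound (B : R) (P : nat -> R) :
  (0 <= B)%R -> (P 0%nat <= 1)%R ->
  (forall n, 0 <= P n)%R ->
  (forall n, P (S n) <= P n * (1 + B * Cmod q ^ n))%R ->
  forall n, (P n <= exp (B / (1 - Cmod q)))%R.
Proof.
  intros HB H0 Hpos HS n; pose proof Cmod_q_pos as Hq.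
  assert (H : (P n <= exp (B * (1 - Cmod q ^ n) / (1 - Cmod q)))%R).
  { induction n as [|n IH].
    - replace (B * (1 - Cmod q ^ 0) / (1 - Cmod q))%R with 0%R
        by (simpl; field; lra).
      now rewrite exp_0.
    - assert (Hp : (0 <= B * Cmod q ^ n)%R)
        by (apply Rmult_le_pos, pow_le; lra).
      replace (B * (1 - Cmod q ^ S n) / (1 - Cmod q))%R with
        (B * (1 - Cmod q ^ n) / (1 - Cmod q) + B * Cmod q ^ n)%R
        by (simpl; field; lra).
      rewrite exp_plus.
      eapply Rle_trans; [apply HS |].
      apply Rmult_le_compat; auto; [lra |].
      apply exp_ineq1_le. }
  eapply Rle_trans; [exact H |].
  assert (exp_le : forall s t, (s <= t)%R -> (exp s <= exp t)%R).
  { intros s t [Hst | ->]; [left; now apply exp_increasing | apply Rle_refl]. }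
  apply exp_le; unfold Rdiv; apply Rmult_le_compat_r.
  - left; apply Rinv_0_lt_compat; lra.
  - assert (0 <= Cmod q ^ n)%R by (apply pow_le; lra). nra.
Qed.

Lemma Cmod_qprod_le (x : C) (n : nat) :
  (Cmod (qprod q x n) <= exp (Cmod x / (1 - Cmod q)))%R.
Proof.
  apply (Rprod_exp_bound (Cmod x) (fun n => Cmod (qprod q x n))).
  - apply Cmod_ge_0.
  - simpl; rewrite Cmod_1; lra.
  - intros m; apply Cmod_ge_0.
  - intros m; simpl; rewrite Cmod_mult.
    apply Rmult_le_compat_l; [apply Cmod_ge_0 |].
    replace (1 - x * q ^ m) with (1 + - (x * q ^ m)) by ring.
    eapply Rle_trans; [apply Cmod_triangle |].
    rewrite Cmod_opp, Cmod_mult, Cmod_pow, Cmod_1; lra.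
Qed.

(** Successive differences of the partial products are [- x q^n (x;q)_n], geometrically small
    because the partial products are bounded. Hence the limit exists, and [iota] returns it. *)
Lemma qprod_clim (x : C) : clim (qprod q x) (qpoch_inf q x).
Proof.
  pose proof Cmod_q_pos as Hq.
  set (f := fun n => - (x * q ^ n) * qprod q x n).
  assert (Hf : forall n,
    (Cmod (f n) <= (Cmod x * exp (Cmod x / (1 - Cmod q))) * Cmod q ^ n)%R).
  { intros n; unfold f; rewrite Cmod_mult, Cmod_opp, Cmod_mult, Cmod_pow.
    pose proof (Cmod_qprod_le x n) as Hb.
    assert (0 <= Cmod x * Cmod q ^ n)%R
      by (apply Rmult_le_pos; [apply Cmod_ge_0 | apply pow_le; lra]).
    nra. }
  assert (Hs : forall n, csum f n = qprod q x (S n) - 1).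
  { induction n as [|n IH].
    - rewrite csum_O; unfold f; simpl; ring.
    - rewrite csum_S, IH; unfold f; simpl; ring. }
  assert (Hl : clim (qprod q x) (1 + cseries f)).
  { assert (H : clim (fun n => qprod q x (S n)) (1 + cseries f)).
    { apply clim_ext with (fun n => 1 + csum f n);
        [intros n; rewrite Hs; ring |].
      apply clim_plus; [apply clim_const |].
      apply is_cseries_clim, (geom_cseries f _ (Cmod q)) with (2 := Hf); lra. }
    unfold clim in *; now apply is_lim_seq_incr_1. }
  exact (eq_ind_r (fun l => clim (qprod q x) l) Hl
    (iota_filterlim_locally (V := C_CompleteNormedModule) (F := eventually)
       (qprod q x) (1 + cseries f) (proj1 (clim_filterlim _ _) Hl))).
Qed.

Lemma qpoch_inf_unique (x l : C) : clim (qprod q x) l -> qpoch_inf q x = l.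
Proof. apply clim_unique, qprod_clim. Qed.

Lemma qpoch_inf_split (x : C) (n : nat) :
  qpoch_inf q x = qprod q x n * qpoch_inf q (x * q ^ n).
Proof.
  apply clim_unique with (fun m => qprod q x (n + m)).
  - apply (clim_subseq (qprod q x)); [intros; lia | apply qprod_clim].
  - apply clim_ext with (fun m => qprod q x n * qprod q (x * q ^ n) m);
      [intros m; now rewrite qprod_add |].
    apply clim_scal, qprod_clim.
Qed.

Lemma qpoch_inf_0 : qpoch_inf q 0 = 1.
Proof.
  apply qpoch_inf_unique, clim_ext with (fun _ => 1); [| apply clim_const].
  induction n as [|n IH]; simpl; [easy | rewrite <- IH; ring].
Qed.

Lemma qprod_neq_0 (x : C) (n : nat) : qpoch_inf q x <> 0 -> qprod q x n <> 0.
Proof. intros H E; apply H; rewrite (qpoch_inf_split x n), E; ring. Qed.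

Lemma qpoch_inf_shift_neq_0 (x : C) (n : nat) :
  qpoch_inf q x <> 0 -> qpoch_inf q (x * q ^ n) <> 0.
Proof. intros H E; apply H; rewrite (qpoch_inf_split x n), E; ring. Qed.

Lemma qfactor_neq_0 (x : C) (n : nat) : qpoch_inf q x <> 0 -> 1 - x * q ^ n <> 0.
Proof.
  intros H E; apply (qprod_neq_0 x (S n) H); simpl; rewrite E; ring.
Qed.

(** Past some index the partial products exceed half the modulus of the limit; before it there are
    finitely many, all nonzero. *)
Lemma qprod_lower_bound (x : C) : qpoch_inf q x <> 0 ->
  exists c : R, (0 < c)%R /\ forall n, (c <= Cmod (qprod q x n))%R.
Proof.
  intros Hx.
  pose proof (proj1 (Cmod_gt_0 _) Hx) as Hl.
  assert (He : (0 < Cmod (qpoch_inf q x) / 2)%R) by lra.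
  destruct (proj2 (is_lim_seq_spec _ _) (clim_Cmod _ _ (qprod_clim x))
              (mkposreal _ He)) as [N HN].
  change (pos (mkposreal _ He)) with (Cmod (qpoch_inf q x) / 2)%R in HN.
  assert (Hfin : exists c : R, (0 < c)%R /\
            forall n, (n < N)%nat -> (c <= Cmod (qprod q x n))%R).
  { clear HN; induction N as [|N [c [Hc IH]]].
    - exists 1%R; split; [lra | intros; lia].
    - exists (Rmin c (Cmod (qprod q x N))); split.
      + apply Rmin_glb_lt; [easy |].
        now apply Cmod_gt_0, qprod_neq_0.
      + intros n Hn; destruct (Nat.eq_dec n N) as [-> | Hne].
        * apply Rmin_r.
        * eapply Rle_trans; [apply Rmin_l | apply IH; lia]. }
  destruct Hfin as [c [Hc Hcn]].
  exists (Rmin c (Cmod (qpoch_inf q x) / 2)); split.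
  - now apply Rmin_glb_lt.
  - intros n; destruct (Nat.lt_ge_cases n N) as [Hn | Hn].
    + eapply Rle_trans; [apply Rmin_l | auto].
    + eapply Rle_trans; [apply Rmin_r |].
      specialize (HN n Hn); apply Rabs_def2 in HN; lra.
Qed.

(* Weierstrass: [|prod (1 - x_j)| >= 1 - sum |x_j|] keeps a late tail of the
   product away from 0. *)
Lemma qpoch_inf_small_neq_0 (x : C) :
  (Cmod x / (1 - Cmod q) <= 1 / 2)%R -> qpoch_inf q x <> 0.
Proof.
  intros Hx; pose proof Cmod_q_pos as Hq; pose proof (Cmod_ge_0 x) as Hx0.
  assert (Hinv : (0 < / (1 - Cmod q))%R) by (apply Rinv_0_lt_compat; lra).
  assert (H : forall n, (1 - Cmod x * (1 - Cmod q ^ n) / (1 - Cmod q)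
            <= Cmod (qprod q x n))%R).
  { induction n as [|n IH].
    - simpl; rewrite Cmod_1; right; field; lra.
    - simpl qprod; rewrite Cmod_mult.
      assert (Hf : (1 - Cmod x * Cmod q ^ n <= Cmod (1 - x * q ^ n))%R).
      { pose proof (Cmod_triangle (1 - x * q ^ n) (x * q ^ n)) as T.
        replace (1 - x * q ^ n + x * q ^ n) with (RtoC 1) in T by ring.
        rewrite Cmod_1, Cmod_mult, Cmod_pow in T; lra. }
      assert (Hp : (0 <= Cmod q ^ n)%R) by (apply pow_le; lra).
      assert (Hp1 : (Cmod q ^ n <= 1)%R) by (rewrite <- (pow1 n); apply pow_incr; lra).
      assert (Hxq : (Cmod x <= 1 - Cmod q)%R).
      { replace (Cmod x) with (Cmod x / (1 - Cmod q) * (1 - Cmod q))%R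
          by (field; lra). nra. }
      set (s := (Cmod x * (1 - Cmod q ^ n) / (1 - Cmod q))%R) in *.
      assert (Hs : (0 <= s)%R).
      { unfold s, Rdiv; apply Rmult_le_pos; [apply Rmult_le_pos |]; lra. }
      assert (Hs1 : (s <= 1)%R).
      { unfold s; apply Rle_trans with (Cmod x / (1 - Cmod q))%R; [| lra].
        unfold Rdiv; apply Rmult_le_compat_r; [lra | nra]. }
      replace (Cmod x * (1 - Cmod q ^ S n) / (1 - Cmod q))%R with
        (s + Cmod x * Cmod q ^ n)%R by (unfold s; simpl; field; lra).
      assert (Ht : (0 <= Cmod x * Cmod q ^ n)%R) by now apply Rmult_le_pos.
      assert (Ht1 : (Cmod x * Cmod q ^ n <= 1)%R) by nra.
      apply Rle_trans with ((1 - s) * (1 - Cmod x * Cmod q ^ n))%R; [nra |].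
      apply Rmult_le_compat; lra. }
  intros E.
  pose proof (clim_Cmod _ _ (qprod_clim x)) as Hl; rewrite E, Cmod_0 in Hl.
  assert (H1 : Rbar_le (1 / 2)%R 0%R).
  { apply (is_lim_seq_le (fun _ => 1 / 2)%R (fun n => Cmod (qprod q x n)));
      [| apply is_lim_seq_const | exact Hl].
    intros n; eapply Rle_trans; [| apply H].
    assert (0 <= Cmod q ^ n)%R by (apply pow_le; lra).
    assert (Cmod x * (1 - Cmod q ^ n) / (1 - Cmod q) <= Cmod x / (1 - Cmod q))%R.
    { unfold Rdiv; apply Rmult_le_compat_r; [lra | nra]. }
    lra. }
  simpl in H1; lra.
Qed.

(** A late tail of the product is nonzero, so the zero comes from one of the finitely many factors
    before it. *)
Lemma qpoch_inf_eq_0 (x : C) : qpoch_inf q x = 0 -> exists n, x * q ^ n = 1.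
Proof.
  intros E; pose proof Cmod_q_pos as Hq.
  assert (Hl : is_lim_seq (fun n => Cmod (x * q ^ n) / (1 - Cmod q))%R 0%R).
  { apply is_lim_seq_ext with (fun n => (Cmod x / (1 - Cmod q)) * Cmod q ^ n)%R.
    - intros n; rewrite Cmod_mult, Cmod_pow; field; lra.
    - replace (Finite 0) with (Finite (Cmod x / (1 - Cmod q) * 0))
        by (f_equal; ring).
      apply is_lim_seq_mult'; [apply is_lim_seq_const |].
      apply is_lim_seq_geom; rewrite Rabs_pos_eq; lra. }
  assert (He : (0 < 1 / 2)%R) by lra.
  destruct (proj2 (is_lim_seq_spec _ _) Hl (mkposreal _ He)) as [N HN].
  specialize (HN N (Nat.le_refl N)).
  change (pos (mkposreal _ He)) with (1 / 2)%R in HN; rewrite Rminus_0_r in HN.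
  assert (HT : qpoch_inf q (x * q ^ N) <> 0).
  { apply qpoch_inf_small_neq_0.
    pose proof (Rle_abs (Cmod (x * q ^ N) / (1 - Cmod q))%R); lra. }
  assert (HP : qprod q x N = 0).
  { destruct (Ceq_dec (qprod q x N) 0) as [Hz | Hz]; [easy |].
    exfalso; apply (Cmult_neq_0 _ _ Hz HT); now rewrite <- qpoch_inf_split. }
  clear HN HT; induction N as [|N IH]; simpl in HP.
  - now exfalso; apply C1_nz.
  - destruct (Ceq_dec (1 - x * q ^ N) 0) as [Hz | Hz].
    + exists N; replace (x * q ^ N) with (1 - (1 - x * q ^ N)) by ring.
      rewrite Hz; ring.
    + apply IH; destruct (Ceq_dec (qprod q x N) 0) as [Hz' | Hz']; [easy |].
      now exfalso; apply (Cmult_neq_0 _ _ Hz' Hz).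
Qed.

Lemma qpoch_inf_q_neq_0 : qpoch_inf q q <> 0.
Proof.
  intros E; apply qpoch_inf_eq_0 in E as [n En].
  pose proof Cmod_q_pos as Hq.
  apply (f_equal Cmod) in En.
  rewrite Cmod_mult, Cmod_pow, Cmod_1 in En.
  assert (Cmod q ^ n <= 1)%R by (rewrite <- (pow1 n); apply pow_incr; lra).
  assert (0 <= Cmod q ^ n)%R by (apply pow_le; lra).
  nra.
Qed.

End NonzeroBase.

(** * One half of the bilateral series *)

(** For [u <> 0] this is [u^n (1/u;q)_n / (aqu;q)_n]. The power of [u] turns [1 - q^m/u] into
    [u - q^m], which makes sense at [u = 0]; there the product is [(-1)^n q^(n(n-1)/2)]. *)
Fixpoint hprod (q a u : C) (n : nat) : C :=
  match n with
  | O => 1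
  | S m => hprod q a u m * ((u - q ^ m) * / (1 - a * q * u * q ^ m))
  end.

(* The terms [n >= 0] of the series with base [a] and parameters [1 / u_i].  The
   terms [n <= 0] are those of the same half series with base [1 / a] and
   parameters [1 / (a u_i)].  With the [u_i] as variables, the limit of an
   infinite parameter is the value at [u_i = 0]. *)
Definition vwp_half (q a u1 u2 u3 u4 : C) (n : nat) : C :=
  (1 - a * (q ^ n * q ^ n)) * / (1 - a) * (q * (a * a)) ^ n
  * (hprod q a u1 n * hprod q a u2 n * hprod q a u3 n * hprod q a u4 n).

(** [x] may be 0, whereas a ratio bounding [hprod] must be positive; the strict inequality leaves
    room to enlarge [x]. *)
Lemma exists_majorant (K x : R) : (0 <= K)%R -> (0 <= x)%R -> (K * x < 1)%R ->
  exists M, (0 < M)%R /\ (x <= M)%R /\ (K * M < 1)%R.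
Proof.
  intros HK Hx H.
  assert (Hi : (0 < / (K + 1))%R) by (apply Rinv_0_lt_compat; lra).
  assert (HKi : (K * / (K + 1) < 1)%R).
  { apply Rmult_lt_reg_r with (K + 1)%R; [lra |].
    rewrite Rmult_assoc, Rinv_l; lra. }
  assert (HKi0 : (0 <= K * / (K + 1))%R) by (apply Rmult_le_pos; lra).
  (* The added amount uses only the fraction [K / (K + 1)] of the gap [1 - K x]. *)
  exists (x + (1 - K * x) * / (K + 1))%R; repeat split; nra.
Qed.

(** The numbers are enlarged one at a time, the other three being absorbed into the constant. *)
Lemma exists_majorants (K x1 x2 x3 x4 : R) : (0 <= K)%R ->
  (0 <= x1)%R -> (0 <= x2)%R -> (0 <= x3)%R -> (0 <= x4)%R ->
  (K * (x1 * x2 * x3 * x4) < 1)%R ->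
  exists M1 M2 M3 M4,
    ((0 < M1 /\ x1 <= M1) /\ (0 < M2 /\ x2 <= M2) /\
     (0 < M3 /\ x3 <= M3) /\ (0 < M4 /\ x4 <= M4) /\
     K * (M1 * M2 * M3 * M4) < 1)%R.
Proof.
  intros HK H1 H2 H3 H4 H.
  destruct (exists_majorant (K * (x2 * x3 * x4)) x1) as [M1 [P1 [L1 B1]]];
    [repeat apply Rmult_le_pos; lra | lra | lra |].
  destruct (exists_majorant (K * (M1 * x3 * x4)) x2) as [M2 [P2 [L2 B2]]];
    [repeat apply Rmult_le_pos; lra | lra | lra |].
  destruct (exists_majorant (K * (M1 * M2 * x4)) x3) as [M3 [P3 [L3 B3]]];
    [repeat apply Rmult_le_pos; lra | lra | lra |].
  destruct (exists_majorant (K * (M1 * M2 * M3)) x4) as [M4 [P4 [L4 B4]]];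
    [repeat apply Rmult_le_pos; lra | lra | lra |].
  exists M1, M2, M3, M4; repeat split; lra.
Qed.

Lemma Cmod_mult4_le (x1 x2 x3 x4 : C) (y1 y2 y3 y4 : R) :
  (Cmod x1 <= y1)%R -> (Cmod x2 <= y2)%R -> (Cmod x3 <= y3)%R ->
  (Cmod x4 <= y4)%R -> (Cmod (x1 * x2 * x3 * x4) <= y1 * y2 * y3 * y4)%R.
Proof.
  intros H1 H2 H3 H4; rewrite !Cmod_mult.
  apply Rmult_le_compat; auto using Cmod_ge_0.
  - repeat apply Rmult_le_pos; apply Cmod_ge_0.
  - apply Rmult_le_compat; auto using Cmod_ge_0.
    + apply Rmult_le_pos; apply Cmod_ge_0.
    + apply Rmult_le_compat; auto using Cmod_ge_0.
Qed.

(** * Geometric bounds uniform under scaling a parameter by powers of [q] *)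

Section NonzeroBase.

Variable q : C.
Hypothesis hq0 : q <> 0.
Hypothesis hq1 : (Cmod q < 1)%R.

Lemma hprod_bound (a u : C) (M : R) :
  qpoch_inf q (a * q * u) <> 0 -> (0 < M)%R -> (Cmod u <= M)%R ->
  exists A, (0 <= A)%R /\
    forall N n, (Cmod (hprod q a (u * q ^ N) n) <= A * M ^ n)%R.
Proof.
  intros Hu HM HuM.
  pose proof (Cmod_q_pos q hq0) as Hq.
  destruct (qprod_lower_bound q hq0 hq1 _ Hu) as [c [Hc Hcn]].
  set (E := exp (Cmod (a * q * u) / (1 - Cmod q))).
  set (B := exp ((/ M) / (1 - Cmod q))).
  assert (HE : (0 < E)%R) by apply exp_pos.
  assert (HB : (0 < B)%R) by apply exp_pos.
  assert (Hci : (0 < / c)%R) by now apply Rinv_0_lt_compat.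
  assert (HMi : (0 < / M)%R) by now apply Rinv_0_lt_compat.
  exists (B * (E * / c))%R; split.
  { left; repeat apply Rmult_lt_0_compat; lra. }
  intros N n.
  assert (HuN : (Cmod (u * q ^ N) <= M)%R).
  { rewrite Cmod_mult, Cmod_pow.
    assert (Cmod q ^ N <= 1)%R by (rewrite <- (pow1 N); apply pow_incr; lra).
    assert (0 <= Cmod q ^ N)%R by (apply pow_le; lra).
    pose proof (Cmod_ge_0 u); nra. }
  set (v := u * q ^ N) in *.
  set (num := fix num (n : nat) : C :=
    match n with O => 1 | S m => num m * (v - q ^ m) end).
  assert (Hv : forall m, 1 - a * q * v * q ^ m <> 0).
  { intros m; replace (a * q * v * q ^ m) with ((a * q * u) * q ^ (N + m))
      by (unfold v; rewrite Cpow_add_r; ring).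
    now apply qfactor_neq_0. }
  assert (Hh : hprod q a v n * qprod q (a * q * v) n = num n).
  { induction n as [|n IH]; [simpl; ring |].
    change (num (S n)) with (num n * (v - q ^ n)); rewrite <- IH.
    simpl; field; apply Hv. }
  assert (Hnum : forall m, (Cmod (num m) * (/ M) ^ m <= B)%R).
  { apply (Rprod_exp_bound q hq0 hq1 (/ M) (fun m => Cmod (num m) * (/ M) ^ m)%R).
    - lra.
    - simpl; rewrite Cmod_1; lra.
    - intros m; apply Rmult_le_pos; [apply Cmod_ge_0 | apply pow_le; lra].
    - intros m; change (num (S m)) with (num m * (v - q ^ m)).
      rewrite Cmod_mult.
      assert (HT : (Cmod (v - q ^ m) <= M + Cmod q ^ m)%R).
      { eapply Rle_trans; [apply Cmod_triangle |].
        rewrite Cmod_opp, Cmod_pow; lra. }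
      assert (HT' : (Cmod (v - q ^ m) * / M <= 1 + / M * Cmod q ^ m)%R).
      { replace (1 + / M * Cmod q ^ m)%R with ((M + Cmod q ^ m) * / M)%R
          by (field; lra).
        apply Rmult_le_compat_r; lra. }
      replace (Cmod (num m) * Cmod (v - q ^ m) * (/ M) ^ S m)%R with
        (Cmod (num m) * (/ M) ^ m * (Cmod (v - q ^ m) * / M))%R by (simpl; ring).
      apply Rmult_le_compat_l; [| exact HT'].
      apply Rmult_le_pos; [apply Cmod_ge_0 | apply pow_le; lra]. }
  (* [(aqu;q)_(N+n)] has modulus at least [c], and the product of its first [N] factors at most [E].
     The rest, the denominator for [v = u q^N], is thus at least [c / E] whatever [N]. *)
  assert (Hden : (c <= E * Cmod (qprod q (a * q * v) n))%R).
  { eapply Rle_trans; [apply (Hcn (N + n)%nat) |].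
    rewrite qprod_add, Cmod_mult.
    replace (a * q * u * q ^ N) with (a * q * v) by (unfold v; ring).
    apply Rmult_le_compat_r; [apply Cmod_ge_0 |].
    now apply Cmod_qprod_le. }
  specialize (Hnum n); apply (f_equal Cmod) in Hh; rewrite Cmod_mult in Hh.
  assert (HMn : (0 < M ^ n)%R) by now apply pow_lt.
  assert (Hnum' : (Cmod (num n) <= B * M ^ n)%R).
  { replace (Cmod (num n)) with (Cmod (num n) * (/ M) ^ n * M ^ n)%R.
    - apply Rmult_le_compat_r; lra.
    - rewrite pow_inv; field; lra. }
  pose proof (Cmod_ge_0 (hprod q a v n)) as Hh0.
  apply Rmult_le_reg_l with c; [lra |].
  replace (c * (B * (E * / c) * M ^ n))%R with (E * (B * M ^ n))%R by (field; lra).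
  eapply Rle_trans; [apply Rmult_le_compat_r; [easy | exact Hden] |].
  rewrite Rmult_assoc, (Rmult_comm (Cmod (qprod _ _ _))), Hh.
  apply Rmult_le_compat_l; lra.
Qed.

Lemma hprod_bound_0 (a u : C) (M : R) :
  qpoch_inf q (a * q * u) <> 0 -> (0 < M)%R -> (Cmod u <= M)%R ->
  exists A, (0 <= A)%R /\ forall n, (Cmod (hprod q a u n) <= A * M ^ n)%R.
Proof.
  intros Hu HM HuM; destruct (hprod_bound a u M Hu HM HuM) as [A [HA H]].
  exists A; split; [easy |]; intros n.
  specialize (H 0%nat n); simpl in H; now rewrite Cmult_1_r in H.
Qed.

Lemma one_minus_bound (x : C) (n : nat) :
  (Cmod (1 - x * q ^ n) <= 1 + Cmod x)%R.
Proof.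
  pose proof (Cmod_q_pos q hq0) as Hq.
  eapply Rle_trans; [apply Cmod_triangle |].
  rewrite Cmod_opp, Cmod_mult, Cmod_pow, Cmod_1.
  assert (Cmod q ^ n <= 1)%R by (rewrite <- (pow1 n); apply pow_incr; lra).
  pose proof (Cmod_ge_0 x); nra.
Qed.

Section Half.

Variables a u1 u2 u3 u4 : C.
Hypothesis ha1 : 1 - a <> 0.
Hypothesis h1 : qpoch_inf q (a * q * u1) <> 0.
Hypothesis h2 : qpoch_inf q (a * q * u2) <> 0.
Hypothesis h3 : qpoch_inf q (a * q * u3) <> 0.
Hypothesis h4 : qpoch_inf q (a * q * u4) <> 0.
Hypothesis ht : (Cmod (q * (a * a) * (u1 * u2 * u3 * u4)) < 1)%R.

Lemma half_majorants :
  exists M1 M2 M3 M4,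
    ((0 < M1 /\ Cmod u1 <= M1) /\ (0 < M2 /\ Cmod u2 <= M2) /\
     (0 < M3 /\ Cmod u3 <= M3) /\ (0 < M4 /\ Cmod u4 <= M4) /\
     0 <= Cmod (q * (a * a)) * (M1 * M2 * M3 * M4) < 1)%R.
Proof.
  destruct (exists_majorants (Cmod (q * (a * a))) (Cmod u1) (Cmod u2) (Cmod u3) (Cmod u4))
    as [M1 [M2 [M3 [M4 [[P1 L1] [[P2 L2] [[P3 L3] [[P4 L4] B]]]]]]]];
    try apply Cmod_ge_0.
  - rewrite <- !Cmod_mult; exact ht.
  - exists M1, M2, M3, M4; repeat split; try lra.
    repeat apply Rmult_le_pos; try lra; apply Cmod_ge_0.
Qed.

Lemma vwp_half_bound : exists A r, (0 <= r < 1)%R /\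
  forall N n, (Cmod (vwp_half q a u1 u2 u3 (u4 * q ^ N) n) <= A * r ^ n)%R.
Proof.
  destruct half_majorants
    as [M1 [M2 [M3 [M4 [[P1 L1] [[P2 L2] [[P3 L3] [[P4 L4] B]]]]]]]].
  destruct (hprod_bound_0 a u1 M1) as [A1 [HA1 B1]]; auto.
  destruct (hprod_bound_0 a u2 M2) as [A2 [HA2 B2]]; auto.
  destruct (hprod_bound_0 a u3 M3) as [A3 [HA3 B3]]; auto.
  destruct (hprod_bound a u4 M4) as [A4 [HA4 B4]]; auto.
  exists ((1 + Cmod a) * Cmod (/ (1 - a)) * (A1 * A2 * A3 * A4))%R.
  exists (Cmod (q * (a * a)) * (M1 * M2 * M3 * M4))%R; split; [exact B |].
  intros N n; unfold vwp_half.
  rewrite !Rpow_mult_distr, <- Cmod_pow.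
  replace ((1 + Cmod a) * Cmod (/ (1 - a)) * (A1 * A2 * A3 * A4) *
    (Cmod ((q * (a * a)) ^ n) * (M1 ^ n * M2 ^ n * M3 ^ n * M4 ^ n)))%R
   with ((1 + Cmod a) * Cmod (/ (1 - a)) * Cmod ((q * (a * a)) ^ n)
     * ((A1 * M1 ^ n) * (A2 * M2 ^ n) * (A3 * M3 ^ n) * (A4 * M4 ^ n)))%R by ring.
  apply Cmod_mult4_le; try apply Rle_refl.
  - rewrite <- Cpow_add_r; apply one_minus_bound.
  - now apply Cmod_mult4_le.
Qed.

Lemma vwp_half_series :
  is_cseries (vwp_half q a u1 u2 u3 u4) (cseries (vwp_half q a u1 u2 u3 u4)).
Proof.
  destruct vwp_half_bound as [A [r [Hr HA]]].
  apply (geom_cseries _ A r Hr); intros n.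
  specialize (HA 0%nat n); simpl in HA; now rewrite Cmult_1_r in HA.
Qed.

Lemma hprod_clim (n : nat) :
  clim (fun N => hprod q a (u4 * q ^ N) n) (hprod q a 0 n).
Proof.
  assert (H0 : clim (fun N => u4 * q ^ N) 0).
  { replace (RtoC 0) with (u4 * 0) by ring; now apply clim_scal, clim_pow. }
  induction n as [|n IH]; [apply (clim_const 1) |].
  simpl; apply clim_mult; [exact IH |]; apply clim_mult.
  - apply clim_minus; [exact H0 | apply clim_const].
  - apply clim_inv.
    + intros N; replace (a * q * (u4 * q ^ N) * q ^ n) with
        ((a * q * u4) * q ^ (N + n)) by (rewrite Cpow_add_r; ring).
      now apply qfactor_neq_0.
    + replace (1 - a * q * 0 * q ^ n) with (RtoC 1) by ring; apply C1_nz.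
    + apply clim_minus; [apply clim_const |].
      apply clim_mult; [| apply clim_const].
      now apply clim_scal.
Qed.

Lemma vwp_half_clim :
  clim (fun N => cseries (vwp_half q a u1 u2 u3 (u4 * q ^ N)))
       (cseries (vwp_half q a u1 u2 u3 0)).
Proof.
  destruct vwp_half_bound as [A [r [Hr HA]]].
  apply (cseries_tannery _ _ A r Hr HA); intros n; unfold vwp_half.
  repeat (apply clim_scal); apply hprod_clim.
Qed.

(** * The telescoping identity for one half *)

Lemma hprod_S (u : C) (n : nat) : qpoch_inf q (a * q * u) <> 0 ->
  hprod q a u (S n) * (1 - a * q * u * q ^ n) = hprod q a u n * (u - q ^ n).
Proof. intros H; simpl; field; now apply qfactor_neq_0. Qed.

Lemma qpoch_inf_q_shift (u : C) :
  qpoch_inf q (a * q * u) <> 0 -> qpoch_inf q (a * q * (u * q)) <> 0.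
Proof.
  intros H; replace (a * q * (u * q)) with ((a * q * u) * q ^ 1)
    by (simpl; ring).
  now apply qpoch_inf_shift_neq_0.
Qed.

(** Replacing [u] by [u q] moves the factors of numerator and denominator by one place, so both
    quotients reduce to their end factors; [q ^ n] comes from pulling [q] out of each
    [u q - q^m]. *)
Lemma hprod_shift (u : C) (n : nat) : qpoch_inf q (a * q * u) <> 0 ->
  (1 - a * q * u) * (1 - q * u) * q ^ n * hprod q a u n
  = hprod q a (u * q) n * (q ^ n - q * u) * (1 - a * q * u * q ^ n).
Proof.
  intros H; induction n as [|n IH]; [simpl; ring |].
  assert (E1 := hprod_S u n H).
  assert (E2 := hprod_S (u * q) n (qpoch_inf_q_shift u H)).
  assert (Hn := qfactor_neq_0 q hq0 hq1 _ n H).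
  apply (Cmult_eq_reg_r (1 - a * q * u * q ^ n)); [| exact Hn].
  rewrite Cpow_S.
  transitivity ((1 - a * q * u) * (1 - q * u) * (q * q ^ n)
    * (hprod q a u (S n) * (1 - a * q * u * q ^ n))); [ring |].
  rewrite E1.
  transitivity (q * (u - q ^ n)
    * ((1 - a * q * u) * (1 - q * u) * q ^ n * hprod q a u n)); [ring |].
  rewrite IH.
  transitivity (q * (q ^ n - u) * (1 - a * q * u * q ^ n)
    * (hprod q a (u * q) (S n) * (1 - a * q * (u * q) * q ^ n))); [| ring].
  rewrite E2; ring.
Qed.

(** A discrete antiderivative in the manner of Gosper, treating the slots [u1, u2, u3, u4 * q]
    alike. For [n > 0] the factor [1 - a u q^n] cancels the last denominator of [hprod q a u n], so
    [certificate (S n)] can be written through [hprod] at [n]. *)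
Definition certificate (n : nat) : C :=
  u4 * q * (a * a) ^ n * / (1 - a)
  * ((hprod q a u1 n * (1 - a * u1 * q ^ n))
     * (hprod q a u2 n * (1 - a * u2 * q ^ n))
     * (hprod q a u3 n * (1 - a * u3 * q ^ n))
     * (hprod q a (u4 * q) n * (1 - a * q * u4 * q ^ n))).

Definition step_lhs : C :=
  (1 - a * q * u4) * (1 - q * u4) * (1 - q * (a * a) * (u1 * u2 * u3) * u4).

Definition step_rhs : C :=
  (1 - a * q * u1 * u4) * (1 - a * q * u2 * u4) * (1 - a * q * u3 * u4).

(** All terms are brought to the common factor formed by [hprod] at [n] for [u1, u2, u3, u4 * q]; a
    polynomial identity in [q ^ n], [q], [a] and the [u_i] remains. *)
Lemma certificate_step (n : nat) :
  step_lhs * vwp_half q a u1 u2 u3 u4 n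
    - step_rhs * vwp_half q a u1 u2 u3 (u4 * q) n
  = certificate (S n) - certificate n.
Proof.
  assert (E : certificate (S n) = u4 * q * (a * a) ^ n * (a * a) * / (1 - a)
    * ((hprod q a u1 n * (u1 - q ^ n)) * (hprod q a u2 n * (u2 - q ^ n))
       * (hprod q a u3 n * (u3 - q ^ n)) * (hprod q a (u4 * q) n * (u4 * q - q ^ n)))).
  { rewrite <- !hprod_S by auto using qpoch_inf_q_shift.
    unfold certificate; rewrite !Cpow_S; ring. }
  assert (E0 : step_lhs * vwp_half q a u1 u2 u3 u4 n
    = (1 - q * (a * a) * (u1 * u2 * u3) * u4)
      * (1 - a * (q ^ n * q ^ n)) * / (1 - a) * (a * a) ^ n
      * (hprod q a u1 n * hprod q a u2 n * hprod q a u3 n)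
      * ((1 - a * q * u4) * (1 - q * u4) * q ^ n * hprod q a u4 n)).
  { unfold step_lhs, vwp_half; rewrite (Cpow_mult_l q (a * a)); ring. }
  rewrite E, E0, hprod_shift by exact h4.
  unfold step_rhs, vwp_half, certificate; rewrite (Cpow_mult_l q (a * a)).
  ring.
Qed.

Lemma certificate_clim : clim certificate 0.
Proof.
  pose proof (Cmod_q_pos q hq0) as Hq.
  destruct half_majorants
    as [M1 [M2 [M3 [M4 [[P1 L1] [[P2 L2] [[P3 L3] [[P4 L4] B]]]]]]]].
  destruct (hprod_bound_0 a u1 M1) as [A1 [HA1 B1]]; auto.
  destruct (hprod_bound_0 a u2 M2) as [A2 [HA2 B2]]; auto.
  destruct (hprod_bound_0 a u3 M3) as [A3 [HA3 B3]]; auto.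
  (* The certificate carries [(a * a) ^ n] instead of [(q * (a * a)) ^ n]; the missing [|q|^n] is
     supplied by the slot [u4 * q], bounded with ratio [M4 * |q|]. *)
  destruct (hprod_bound_0 a (u4 * q) (M4 * Cmod q)) as [A4 [HA4 B4]];
    [now apply qpoch_inf_q_shift | nra
    | rewrite Cmod_mult; apply Rmult_le_compat_r; lra |].
  apply clim_le with (fun n => (Cmod (u4 * q * / (1 - a)) * (A1 * A2 * A3 * A4)
    * ((1 + Cmod (a * u1)) * (1 + Cmod (a * u2)) * (1 + Cmod (a * u3))
       * (1 + Cmod (a * q * u4))))
    * (Cmod (q * (a * a)) * (M1 * M2 * M3 * M4)) ^ n)%R.
  - intros n; replace (certificate n - 0) with (u4 * q * / (1 - a) * (a * a) ^ n
      * ((hprod q a u1 n * (1 - a * u1 * q ^ n))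
         * (hprod q a u2 n * (1 - a * u2 * q ^ n))
         * (hprod q a u3 n * (1 - a * u3 * q ^ n))
         * (hprod q a (u4 * q) n * (1 - a * q * u4 * q ^ n))))
      by (unfold certificate; ring).
    rewrite (Cmod_mult q (a * a)), !Rpow_mult_distr.
    match goal with |- (_ <= ?X)%R => replace X with
      (Cmod (u4 * q * / (1 - a)) * Cmod (a * a) ^ n
       * (((A1 * M1 ^ n) * (1 + Cmod (a * u1)))
          * ((A2 * M2 ^ n) * (1 + Cmod (a * u2)))
          * ((A3 * M3 ^ n) * (1 + Cmod (a * u3)))
          * ((A4 * (M4 * Cmod q) ^ n) * (1 + Cmod (a * q * u4)))))%R
      by (rewrite Rpow_mult_distr; ring) end.
    rewrite <- Cmod_pow, Cmod_mult, (Cmod_mult (u4 * q * / (1 - a))).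
    apply Rmult_le_compat_l; [apply Rmult_le_pos; apply Cmod_ge_0 |].
    apply Cmod_mult4_le; rewrite Cmod_mult; apply Rmult_le_compat;
      try apply Cmod_ge_0; try apply one_minus_bound; auto.
  - match goal with |- is_lim_seq (fun n => (?X * ?r ^ n)%R) _ =>
      replace (Finite 0) with (Finite (X * 0)) by (f_equal; ring) end.
    apply is_lim_seq_mult'; [apply is_lim_seq_const |].
    apply is_lim_seq_geom; rewrite Rabs_pos_eq; lra.
Qed.

Lemma csum_certificate (n : nat) :
  step_lhs * csum (vwp_half q a u1 u2 u3 u4) n
    - step_rhs * csum (vwp_half q a u1 u2 u3 (u4 * q)) n
  = certificate (S n) - certificate 0.
Proof.
  induction n as [|n IH].
  - rewrite !csum_O; apply certificate_step.
  - rewrite !csum_S.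
    replace (certificate (S (S n)) - certificate 0) with
      ((certificate (S (S n)) - certificate (S n))
       + (certificate (S n) - certificate 0)) by ring.
    rewrite <- IH, <- certificate_step; ring.
Qed.

End Half.

(** The certificate tends to 0, so only its value at [n = 0] survives; the other half compensates
    for it. *)
Lemma vwp_half_step (a u1 u2 u3 u4 : C) :
  1 - a <> 0 ->
  qpoch_inf q (a * q * u1) <> 0 -> qpoch_inf q (a * q * u2) <> 0 ->
  qpoch_inf q (a * q * u3) <> 0 -> qpoch_inf q (a * q * u4) <> 0 ->
  (Cmod (q * (a * a) * (u1 * u2 * u3 * u4)) < 1)%R ->
  step_lhs a u1 u2 u3 u4 * cseries (vwp_half q a u1 u2 u3 u4)
    - step_rhs a u1 u2 u3 u4 * cseries (vwp_half q a u1 u2 u3 (u4 * q))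
  = - certificate a u1 u2 u3 u4 0.
Proof.
  intros ha1 h1 h2 h3 h4 ht.
  assert (h4q := qpoch_inf_q_shift a u4 h4).
  assert (htq : (Cmod (q * (a * a) * (u1 * u2 * u3 * (u4 * q))) < 1)%R).
  { replace (q * (a * a) * (u1 * u2 * u3 * (u4 * q))) with
      (q * (a * a) * (u1 * u2 * u3 * u4) * q) by ring.
    rewrite Cmod_mult.
    pose proof (Cmod_ge_0 q); pose proof (Cmod_ge_0 (q * (a * a) * (u1 * u2 * u3 * u4))).
    nra. }
  apply clim_unique with (fun n =>
    step_lhs a u1 u2 u3 u4 * csum (vwp_half q a u1 u2 u3 u4) n
    - step_rhs a u1 u2 u3 u4 * csum (vwp_half q a u1 u2 u3 (u4 * q)) n).
  - apply clim_minus; apply clim_scal, is_cseries_clim, vwp_half_series; auto.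
  - apply clim_ext with (fun n => certificate a u1 u2 u3 u4 (S n)
      - certificate a u1 u2 u3 u4 0).
    + intros n; symmetry; now apply csum_certificate.
    + replace (- certificate a u1 u2 u3 u4 0) with
        (0 - certificate a u1 u2 u3 u4 0) by ring.
      apply clim_minus; [| apply clim_const].
      apply (clim_subseq (certificate a u1 u2 u3 u4)); [intros; lia |].
      now apply certificate_clim.
Qed.

End NonzeroBase.

(** * The bilateral series *)

Section NonzeroBase.

Variable q : C.
Hypothesis hq0 : q <> 0.
Hypothesis hq1 : (Cmod q < 1)%R.

(** The term [(-1)^k q^(k(k-1)/2) a^k] of the partial theta series. *)
Definition theta_term (a : C) (k : nat) : C := a ^ k * hprod q 0 0 k.

Lemma hprod_0_indep (a : C) (n : nat) : hprod q a 0 n = hprod q 0 0 n.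
Proof.
  induction n as [|n IH]; [easy |]; simpl; rewrite IH.
  replace (a * q * 0 * q ^ n) with (RtoC 0) by ring.
  now replace (0 * q * 0 * q ^ n) with (RtoC 0) by ring.
Qed.

Lemma hprod_0_S (n : nat) : hprod q 0 0 (S n) = - q ^ n * hprod q 0 0 n.
Proof.
  simpl; replace (1 - 0 * q * 0 * q ^ n) with (RtoC 1) by ring; field.
Qed.

Lemma theta_series (a : C) : is_cseries (theta_term a) (cseries (theta_term a)).
Proof.
  pose proof (Cmod_ge_0 a) as Ha.
  (* At [u = 0] every ratio [M > 0] is allowed for [hprod]; taking [|a| M < 1] gives convergence for
     all [a]. *)
  destruct (exists_majorant (Cmod a) 0) as [M [HM [_ HaM]]]; [easy | lra | lra |].
  destruct (hprod_bound_0 q hq0 hq1 0 0 M) as [A [HA HB]]; auto.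
  { replace (0 * q * 0) with (RtoC 0) by ring.
    rewrite (qpoch_inf_0 q hq0 hq1); apply C1_nz. }
  { rewrite Cmod_0; lra. }
  apply (geom_cseries _ A (Cmod a * M)).
  - split; [apply Rmult_le_pos |]; lra.
  - intros n; unfold theta_term; rewrite Cmod_mult, Cmod_pow, Rpow_mult_distr.
    replace (A * (Cmod a ^ n * M ^ n))%R with (Cmod a ^ n * (A * M ^ n))%R by ring.
    apply Rmult_le_compat_l; [now apply pow_le | apply HB].
Qed.

Lemma theta_shift (a : C) :
  cseries (theta_term a) = 1 - a * cseries (theta_term (q * a)).
Proof.
  apply cseries_unique, is_cseries_clim.
  assert (H : clim (fun n => csum (theta_term a) (S n))
                (1 - a * cseries (theta_term (q * a)))).
  { apply clim_ext with (fun n => 1 - a * csum (theta_term (q * a)) n).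
    - assert (HS : forall k, theta_term a (S k) = - a * theta_term (q * a) k).
      { intros k; unfold theta_term; rewrite hprod_0_S, Cpow_S, Cpow_mult_l; ring. }
      induction n as [|n IH].
      + rewrite csum_S, !csum_O, HS; unfold theta_term at 2; simpl; ring.
      + rewrite (csum_S (theta_term a)), <- IH, HS, (csum_S _ n); ring.
    - apply clim_minus; [apply clim_const |].
      apply clim_scal, is_cseries_clim, theta_series. }
  unfold clim in *; now apply is_lim_seq_incr_1.
Qed.

(* Pairing consecutive terms of the partial theta series gives half of the
   very-well-poised series without parameters. *)
Lemma vwp_half_theta (a : C) : 1 - a <> 0 ->
  cseries (vwp_half q a 0 0 0 0) = cseries (theta_term a) / (1 - a).
Proof.
  intros ha1; apply cseries_unique, is_cseries_clim.
  assert (HT : forall n, theta_term a (2 * n)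
             = (q * (a * a)) ^ n * (hprod q a 0 n * hprod q a 0 n
                 * hprod q a 0 n * hprod q a 0 n)).
  { induction n as [|n IH]; [unfold theta_term; simpl; ring |].
    rewrite !hprod_0_indep in IH |- *; unfold theta_term in *.
    replace (2 * S n)%nat with (S (S (2 * n))) by lia.
    rewrite !hprod_0_S, !Cpow_S.
    transitivity (a * a * q * (q ^ (2 * n) * q ^ (2 * n))
      * (a ^ (2 * n) * hprod q 0 0 (2 * n))); [ring |].
    rewrite IH; replace (2 * n)%nat with (n + n)%nat by lia.
    rewrite Cpow_add_r; ring. }
  assert (HT' : forall n, theta_term a (S (2 * n))
             = - (a * (q ^ n * q ^ n)) * theta_term a (2 * n)).
  { intros n; unfold theta_term; rewrite hprod_0_S, Cpow_S.
    rewrite <- Cpow_add_r; replace (n + n)%nat with (2 * n)%nat by lia; ring. }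
  assert (Hv : forall n, vwp_half q a 0 0 0 0 n
     = / (1 - a) * (theta_term a (2 * n) + theta_term a (S (2 * n)))).
  { intros n; rewrite HT', HT; unfold vwp_half; ring. }
  apply clim_ext with (fun n => / (1 - a) * csum (theta_term a) (S (2 * n))).
  - induction n as [|n IH].
    + change (S (2 * 0)) with 1%nat; rewrite csum_S, !csum_O, Hv; easy.
    + rewrite (csum_S (vwp_half _ _ _ _ _ _)), <- IH, Hv.
      replace (S (2 * S n)) with (S (S (S (2 * n)))) by lia.
      replace (2 * S n)%nat with (S (S (2 * n))) by lia.
      rewrite (csum_S _ (S (S (2 * n)))), (csum_S _ (S (2 * n))); ring.
  - replace (cseries (theta_term a) / (1 - a)) with
      (/ (1 - a) * cseries (theta_term a)) by (unfold Cdiv; ring).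
    apply clim_scal, (clim_subseq (csum (theta_term a)) _ (fun n => S (2 * n)));
      [intros; lia |].
    apply is_cseries_clim, theta_series.
Qed.

(** The bilateral theta series, the sum over all integers [k] of [(-1)^k q^(k(k-1)/2) a^k]. Under
    [k = 1 - j] the second series covers [k <= 1]; the terms [k = 0, 1], namely [1] and [- a], are
    counted twice and subtracted once. *)
Definition jacobi (a : C) : C :=
  cseries (theta_term a) - a * cseries (theta_term (/ a)) - 1 + a.

Lemma jacobi_shift (a : C) : a <> 0 -> a * jacobi (q * a) = - jacobi a.
Proof.
  intros ha; unfold jacobi.
  rewrite (theta_shift a), (theta_shift (/ (q * a))).
  replace (q * / (q * a)) with (/ a) by (field; auto).
  field; auto.
Qed.

Lemma jacobi_inv (a : C) : a <> 0 -> a * jacobi (/ a) = - jacobi a.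
Proof.
  intros ha; unfold jacobi.
  replace (/ / a) with a by (field; exact ha).
  field; exact ha.
Qed.

(** At [a = 1] the two series cancel; [jacobi_shift] carries the zero from one power of [q] to the
    next. *)
Lemma jacobi_pow (n : nat) : jacobi (q ^ n) = 0.
Proof.
  induction n as [|n IH].
  - unfold jacobi; simpl; replace (/ RtoC 1) with (RtoC 1) by field; ring.
  - pose proof (jacobi_shift (q ^ n) (Cpow_nz _ n hq0)) as H.
    rewrite IH in H; rewrite Cpow_S.
    apply (Cmult_eq_reg_r (q ^ n)); [| now apply Cpow_nz].
    rewrite Cmult_comm, H; ring.
Qed.

(* Both halves contain the term [n = 0], which is 1. *)
Definition bisum (a u1 u2 u3 u4 : C) : C :=
  cseries (vwp_half q a u1 u2 u3 u4)
  + cseries (vwp_half q (/ a) (a * u1) (a * u2) (a * u3) (a * u4)) - 1.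

(** The reduction acts on the last slot only; rotation brings each parameter there in turn. *)
Lemma bisum_rot (a u1 u2 u3 u4 : C) : bisum a u1 u2 u3 u4 = bisum a u4 u1 u2 u3.
Proof.
  assert (H : forall b v1 v2 v3 v4, vwp_half q b v1 v2 v3 v4 = vwp_half q b v4 v1 v2 v3).
  { intros; apply functional_extensionality; intros n; unfold vwp_half; ring. }
  unfold bisum; now rewrite (H a), (H (/ a)).
Qed.

(** * Reduction of the bilateral sum for a fixed base *)

Section FixedBase.

Variable a : C.
Hypothesis ha0 : a <> 0.
Hypothesis ha1 : 1 - a <> 0.

(** The two products govern the denominators of the two halves: for base [/ a] and parameter
    [a * u], the quantity [/ a * q * (a * u)] is [q * u]. *)
Definition regular (u : C) : Prop :=
  qpoch_inf q (a * q * u) <> 0 /\ qpoch_inf q (q * u) <> 0.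

Lemma one_minus_inv : 1 - / a <> 0.
Proof.
  intros E; apply ha1; replace (1 - a) with (- a * (1 - / a)) by (field; exact ha0).
  rewrite E; ring.
Qed.

Lemma regular_0 : regular 0.
Proof.
  split; [replace (a * q * 0) with (RtoC 0) by ring
         | replace (q * 0) with (RtoC 0) by ring];
    rewrite (qpoch_inf_0 q hq0 hq1); apply C1_nz.
Qed.

Lemma regular_inv (u : C) : regular u -> qpoch_inf q (/ a * q * (a * u)) <> 0.
Proof.
  intros [_ H]; now replace (/ a * q * (a * u)) with (q * u) by (field; exact ha0).
Qed.

Lemma regular_pow (u : C) (n : nat) : regular u -> regular (u * q ^ n).
Proof.
  intros [H1 H2]; split.
  - replace (a * q * (u * q ^ n)) with (a * q * u * q ^ n) by ring.
    now apply qpoch_inf_shift_neq_0.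
  - replace (q * (u * q ^ n)) with (q * u * q ^ n) by ring.
    now apply qpoch_inf_shift_neq_0.
Qed.

Lemma argument_inv (u1 u2 u3 u4 : C) :
  q * (/ a * / a) * (a * u1 * (a * u2) * (a * u3) * (a * u4))
  = q * (a * a) * (u1 * u2 * u3 * u4).
Proof. field; exact ha0. Qed.

Lemma bisum_step (u1 u2 u3 u4 : C) :
  regular u1 -> regular u2 -> regular u3 -> regular u4 ->
  (Cmod (q * (a * a) * (u1 * u2 * u3 * u4)) < 1)%R ->
  step_lhs q a u1 u2 u3 u4 * bisum a u1 u2 u3 u4
  = step_rhs q a u1 u2 u3 u4 * bisum a u1 u2 u3 (u4 * q).
Proof.
  intros h1 h2 h3 h4 ht.
  assert (E1 := vwp_half_step q hq0 hq1 a u1 u2 u3 u4 ha1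
    (proj1 h1) (proj1 h2) (proj1 h3) (proj1 h4) ht).
  rewrite <- argument_inv in ht.
  assert (E2 := vwp_half_step q hq0 hq1 (/ a) (a * u1) (a * u2) (a * u3) (a * u4)
    one_minus_inv (regular_inv _ h1) (regular_inv _ h2) (regular_inv _ h3)
    (regular_inv _ h4) ht).
  replace (step_lhs q (/ a) (a * u1) (a * u2) (a * u3) (a * u4))
    with (step_lhs q a u1 u2 u3 u4) in E2
    by (unfold step_lhs; field; exact ha0).
  replace (step_rhs q (/ a) (a * u1) (a * u2) (a * u3) (a * u4))
    with (step_rhs q a u1 u2 u3 u4) in E2
    by (unfold step_rhs; field; exact ha0).
  rewrite <- Cmult_assoc in E2.
  (* The two boundary terms add up to [step_lhs - step_rhs], exactly what the [- 1] in [bisum]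
     contributes on the two sides; the relation becomes homogeneous. *)
  assert (E3 : - certificate q a u1 u2 u3 u4 0
      - certificate q (/ a) (a * u1) (a * u2) (a * u3) (a * u4) 0
      = step_lhs q a u1 u2 u3 u4 - step_rhs q a u1 u2 u3 u4).
  { unfold certificate, step_lhs, step_rhs; simpl.
    field; repeat split; auto.
    intros E; apply ha1; replace (1 - a) with (- (a - 1)) by ring.
    rewrite E; ring. }
  rewrite <- E1 in E3.
  unfold Cminus at 1 in E3; rewrite <- E2 in E3.
  unfold bisum.
  set (L := step_lhs q a u1 u2 u3 u4) in *; set (R := step_rhs q a u1 u2 u3 u4) in *.
  match type of E3 with ?x - ?y + (?z - ?w) = ?s - ?t =>
    transitivity ((x - y + (z - w)) - (s - t) + y + w - t); [ring |] end.
  rewrite E3; ring.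
Qed.

Lemma bisum_clim (u1 u2 u3 u4 : C) :
  regular u1 -> regular u2 -> regular u3 -> regular u4 ->
  (Cmod (q * (a * a) * (u1 * u2 * u3 * u4)) < 1)%R ->
  clim (fun N => bisum a u1 u2 u3 (u4 * q ^ N)) (bisum a u1 u2 u3 0).
Proof.
  intros h1 h2 h3 h4 ht; unfold bisum.
  apply clim_minus; [apply clim_plus |]; [| | apply clim_const].
  - apply vwp_half_clim; try exact ht; try exact ha1; now apply proj1 in h1, h2, h3, h4.
  - replace (a * 0) with (RtoC 0) by ring.
    apply clim_ext with (fun N => cseries
      (vwp_half q (/ a) (a * u1) (a * u2) (a * u3) (a * u4 * q ^ N))).
    + intros N; now rewrite Cmult_assoc.
    + apply vwp_half_clim; auto using regular_inv.
      now rewrite argument_inv.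
Qed.

Lemma bisum_iter (u1 u2 u3 u4 : C) (N : nat) :
  regular u1 -> regular u2 -> regular u3 -> regular u4 ->
  (Cmod (q * (a * a) * (u1 * u2 * u3 * u4)) < 1)%R ->
  qprod q (a * q * u4) N * qprod q (q * u4) N
    * qprod q (q * (a * a) * (u1 * u2 * u3 * u4)) N * bisum a u1 u2 u3 u4
  = qprod q (a * q * (u1 * u4)) N * qprod q (a * q * (u2 * u4)) N
    * qprod q (a * q * (u3 * u4)) N * bisum a u1 u2 u3 (u4 * q ^ N).
Proof.
  intros h1 h2 h3 h4 ht; induction N as [|N IH].
  - replace (u4 * q ^ 0) with u4 by (simpl; ring); simpl; ring.
  - assert (htN : (Cmod (q * (a * a) * (u1 * u2 * u3 * (u4 * q ^ N))) < 1)%R).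
    { replace (q * (a * a) * (u1 * u2 * u3 * (u4 * q ^ N))) with
        (q * (a * a) * (u1 * u2 * u3 * u4) * q ^ N) by ring.
      rewrite Cmod_mult, Cmod_pow.
      pose proof (Cmod_q_pos q hq0) as Hq.
      assert (Cmod q ^ N <= 1)%R by (rewrite <- (pow1 N); apply pow_incr; lra).
      assert (0 <= Cmod q ^ N)%R by (apply pow_le; lra).
      pose proof (Cmod_ge_0 (q * (a * a) * (u1 * u2 * u3 * u4))); nra. }
    assert (E := bisum_step u1 u2 u3 (u4 * q ^ N) h1 h2 h3 (regular_pow _ N h4) htN).
    replace (u4 * q ^ S N) with (u4 * q ^ N * q) by (rewrite Cpow_S; ring).
    simpl qprod.
    transitivity (step_lhs q a u1 u2 u3 (u4 * q ^ N) *
      (qprod q (a * q * u4) N * qprod q (q * u4) N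
       * qprod q (q * (a * a) * (u1 * u2 * u3 * u4)) N * bisum a u1 u2 u3 u4));
      [unfold step_lhs; ring |].
    rewrite IH.
    transitivity (qprod q (a * q * (u1 * u4)) N * qprod q (a * q * (u2 * u4)) N
      * qprod q (a * q * (u3 * u4)) N
      * (step_rhs q a u1 u2 u3 (u4 * q ^ N) * bisum a u1 u2 u3 (u4 * q ^ N * q)));
      [rewrite <- E; ring | unfold step_rhs; ring].
Qed.

Lemma bisum_reduce (u1 u2 u3 u4 : C) :
  regular u1 -> regular u2 -> regular u3 -> regular u4 ->
  (Cmod (q * (a * a) * (u1 * u2 * u3 * u4)) < 1)%R ->
  qpoch_inf q (a * q * u4) * qpoch_inf q (q * u4)
    * qpoch_inf q (q * (a * a) * (u1 * u2 * u3 * u4)) * bisum a u1 u2 u3 u4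
  = qpoch_inf q (a * q * (u1 * u4)) * qpoch_inf q (a * q * (u2 * u4))
    * qpoch_inf q (a * q * (u3 * u4)) * bisum a u1 u2 u3 0.
Proof.
  intros h1 h2 h3 h4 ht.
  eapply clim_unique.
  - apply clim_mult; [apply clim_mult; [apply clim_mult |] | apply clim_const];
      now apply qprod_clim.
  - eapply clim_ext; [intros N; symmetry; apply bisum_iter; auto |].
    apply clim_mult; [apply clim_mult; [apply clim_mult |] | now apply bisum_clim];
      now apply qprod_clim.
Qed.

Lemma qpoch_inf_mul_0 (x y : C) : x = 0 -> qpoch_inf q (y * x) = 1.
Proof.
  intros ->; rewrite Cmult_0_r; apply (qpoch_inf_0 q hq0 hq1).
Qed.

(** A zero parameter makes the argument 0, so the convergence condition is automatic and two of the
    q-products equal 1. *)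
Lemma bisum_reduce_0 (u2 u3 u4 : C) : regular u2 -> regular u3 -> regular u4 ->
  qpoch_inf q (a * q * u4) * qpoch_inf q (q * u4) * bisum a 0 u2 u3 u4
  = qpoch_inf q (a * q * (u2 * u4)) * qpoch_inf q (a * q * (u3 * u4))
    * bisum a 0 u2 u3 0.
Proof.
  intros h2 h3 h4.
  assert (ht : 0 * u2 * u3 * u4 = 0) by ring.
  assert (E := bisum_reduce 0 u2 u3 u4 regular_0 h2 h3 h4).
  rewrite (qpoch_inf_mul_0 (0 * u2 * u3 * u4)), (qpoch_inf_mul_0 (0 * u4)) in E
    by ring.
  rewrite ht, Cmult_0_r, Cmod_0, Cmult_1_r, Cmult_1_l in E.
  exact (E Rlt_0_1).
Qed.

(** Removing [u4], [u3], [u2], [u1] in this order pairs each with the parameters still present,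
    whence the six products over pairs. *)
Lemma bisum_reduce_all (u1 u2 u3 u4 : C) :
  regular u1 -> regular u2 -> regular u3 -> regular u4 ->
  (Cmod (q * (a * a) * (u1 * u2 * u3 * u4)) < 1)%R ->
  qpoch_inf q (a * q * u1) * qpoch_inf q (q * u1)
  * (qpoch_inf q (a * q * u2) * qpoch_inf q (q * u2))
  * (qpoch_inf q (a * q * u3) * qpoch_inf q (q * u3))
  * (qpoch_inf q (a * q * u4) * qpoch_inf q (q * u4))
  * qpoch_inf q (q * (a * a) * (u1 * u2 * u3 * u4)) * bisum a u1 u2 u3 u4
  = qpoch_inf q (a * q * (u1 * u2)) * qpoch_inf q (a * q * (u1 * u3))
    * qpoch_inf q (a * q * (u1 * u4)) * qpoch_inf q (a * q * (u2 * u3))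
    * qpoch_inf q (a * q * (u2 * u4)) * qpoch_inf q (a * q * (u3 * u4))
    * bisum a 0 0 0 0.
Proof.
  intros h1 h2 h3 h4 ht; pose proof regular_0 as h0.
  assert (E4 := bisum_reduce u1 u2 u3 u4 h1 h2 h3 h4 ht).
  rewrite (bisum_rot a u1 u2 u3 0) in E4.
  assert (E3 := bisum_reduce_0 u1 u2 u3 h1 h2 h3).
  rewrite (bisum_rot a 0 u1 u2 0) in E3.
  assert (E2 := bisum_reduce_0 0 u1 u2 h0 h1 h2).
  rewrite (qpoch_inf_mul_0 (0 * u2)), Cmult_1_l, (bisum_rot a 0 0 u1 0) in E2 by ring.
  assert (E1 := bisum_reduce_0 0 0 u1 h0 h0 h1).
  rewrite (qpoch_inf_mul_0 (0 * u1)), !Cmult_1_l in E1 by ring.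
  transitivity (qpoch_inf q (a * q * (u1 * u4)) * qpoch_inf q (a * q * (u2 * u4))
    * qpoch_inf q (a * q * (u3 * u4))
    * (qpoch_inf q (a * q * (u1 * u3)) * qpoch_inf q (a * q * (u2 * u3))
       * (qpoch_inf q (a * q * (u1 * u2)) * bisum a 0 0 0 0))); [| ring].
  rewrite <- E1.
  transitivity (qpoch_inf q (a * q * u1) * qpoch_inf q (q * u1)
  * (qpoch_inf q (a * q * u2) * qpoch_inf q (q * u2))
  * (qpoch_inf q (a * q * u3) * qpoch_inf q (q * u3))
  * (qpoch_inf q (a * q * (u1 * u4)) * qpoch_inf q (a * q * (u2 * u4))
    * qpoch_inf q (a * q * (u3 * u4)) * bisum a 0 u1 u2 u3)); [rewrite <- E4; ring |].
  transitivity (qpoch_inf q (a * q * u1) * qpoch_inf q (q * u1)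
  * (qpoch_inf q (a * q * u2) * qpoch_inf q (q * u2))
  * (qpoch_inf q (a * q * (u1 * u4)) * qpoch_inf q (a * q * (u2 * u4))
    * qpoch_inf q (a * q * (u3 * u4)))
  * (qpoch_inf q (a * q * (u1 * u3)) * qpoch_inf q (a * q * (u2 * u3))
      * bisum a 0 0 u1 u2)); [rewrite <- E3; ring |].
  transitivity (qpoch_inf q (a * q * u1) * qpoch_inf q (q * u1)
  * (qpoch_inf q (a * q * (u1 * u4)) * qpoch_inf q (a * q * (u2 * u4))
    * qpoch_inf q (a * q * (u3 * u4)))
  * (qpoch_inf q (a * q * (u1 * u3)) * qpoch_inf q (a * q * (u2 * u3)))
  * (qpoch_inf q (a * q * (u1 * u2)) * bisum a 0 0 0 u1)); [rewrite <- E2; ring | ring].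
Qed.

Lemma vwp_half_trivial (b v : C) : 1 - b <> 0 ->
  cseries (vwp_half q b v 1 0 0) = 1.
Proof.
  intros hb; apply cseries_unique, is_cseries_clim.
  assert (H1 : forall n, hprod q b 1 (S n) = 0).
  { induction n as [|n IH]; [simpl; ring |].
    change (hprod q b 1 (S (S n))) with
      (hprod q b 1 (S n) * ((1 - q ^ S n) * / (1 - b * q * 1 * q ^ S n))).
    rewrite IH; ring. }
  apply clim_ext with (fun _ => 1); [| apply clim_const].
  induction n as [|n IH].
  - rewrite csum_O; unfold vwp_half; simpl; field; exact hb.
  - rewrite csum_S, <- IH; unfold vwp_half; rewrite H1; ring.
Qed.

(** Inverting the base turns [u = / a] into 1, so each half has a parameter 1 and stops after its
    first term; the total is [1 + 1 - 1]. *)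
Lemma bisum_trivial : bisum a (/ a) 1 0 0 = 1.
Proof.
  unfold bisum; rewrite vwp_half_trivial by exact ha1.
  assert (E : vwp_half q (/ a) (a * / a) (a * 1) (a * 0) (a * 0)
            = vwp_half q (/ a) a 1 0 0).
  { replace (a * / a) with (RtoC 1) by (field; exact ha0).
    replace (a * 0) with (RtoC 0) by ring; rewrite Cmult_1_r.
    apply functional_extensionality; intros n; unfold vwp_half; ring. }
  rewrite E, vwp_half_trivial by exact one_minus_inv; ring.
Qed.

(** From [(1 - a) / (1 - / a) = - a]; the correction [- 1 + a] in [jacobi] is the doubly counted
    central term times [1 - a]. *)
Lemma bisum_jacobi : (1 - a) * bisum a 0 0 0 0 = jacobi a.
Proof.
  unfold bisum, jacobi; replace (a * 0) with (RtoC 0) by ring.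
  rewrite !vwp_half_theta by (exact ha1 || exact one_minus_inv).
  field; repeat split; auto.
  intros E; apply ha1; replace (1 - a) with (- (a - 1)) by ring.
  rewrite E; ring.
Qed.

(** With [bisum_jacobi] this is Jacobi's triple product, after division by [1 - a]. *)
Lemma bisum_no_parameter :
  bisum a 0 0 0 0 = qpoch_inf q q * qpoch_inf q (a * q) * qpoch_inf q (q / a).
Proof.
  assert (Hz : jacobi a = 0 -> bisum a 0 0 0 0 = 0).
  { intros E; apply (Cmult_eq_reg_r (1 - a)); [| exact ha1].
    rewrite Cmult_comm, bisum_jacobi, E; ring. }
  (* [(aq;q)_oo = 0] means that [a = q^(-n-1)] for some [n], and [(q/a;q)_oo = 0] that
     [a = q^(n+1)]. In these cases [regular] fails for [1] or [/ a], and both sides are shown to be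
     0. *)
  destruct (Ceq_dec (qpoch_inf q (a * q)) 0) as [E | H1].
  { rewrite E; transitivity (RtoC 0); [| ring]; apply Hz.
    apply (qpoch_inf_eq_0 q hq0 hq1) in E as [n En].
    assert (E : / a = q ^ S n).
    { apply (Cmult_eq_reg_r a); [| exact ha0].
      rewrite Cinv_l, <- En by exact ha0; simpl; ring. }
    pose proof (jacobi_inv a ha0) as H; rewrite E, jacobi_pow in H.
    replace (jacobi a) with (- - jacobi a) by ring; rewrite <- H; ring. }
  destruct (Ceq_dec (qpoch_inf q (q / a)) 0) as [E | H2].
  { rewrite E; transitivity (RtoC 0); [| ring]; apply Hz.
    apply (qpoch_inf_eq_0 q hq0 hq1) in E as [n En].
    replace a with (q ^ S n); [apply jacobi_pow |].
    rewrite <- (Cmult_1_r a), <- En; simpl; field; exact ha0. }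
  pose proof (qpoch_inf_q_neq_0 q hq0 hq1) as Hq.
  assert (hr1 : regular (/ a)).
  { split; [replace (a * q * / a) with q by (field; exact ha0) | exact H2]; exact Hq. }
  assert (hr2 : regular 1).
  { split; [replace (a * q * 1) with (a * q) by ring; exact H1
           | replace (q * 1) with q by ring; exact Hq]. }
  assert (ht : q * (a * a) * (/ a * 1 * 0 * 0) = 0) by ring.
  assert (E := bisum_reduce_all (/ a) 1 0 0 hr1 hr2 regular_0 regular_0).
  rewrite bisum_trivial, ht, Cmod_0 in E; specialize (E Rlt_0_1).
  replace (a * q * / a) with q in E by (field; exact ha0).
  replace (a * q * (/ a * 1)) with q in E by (field; exact ha0).
  replace (a * q * 1) with (a * q) in E by ring.
  replace (a * q * (/ a * 0)) with (RtoC 0) in E by ring.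
  replace (a * q * (1 * 0)) with (RtoC 0) in E by ring.
  replace (a * q * (0 * 0)) with (RtoC 0) in E by ring.
  replace (a * q * 0) with (RtoC 0) in E by ring.
  replace (q * 0) with (RtoC 0) in E by ring.
  replace (q * 1) with q in E by ring.
  rewrite (qpoch_inf_0 q hq0 hq1) in E.
  (* The parameters [/ a] and [1] each contribute one [(q;q)_oo], their pair one on the other side;
     one factor cancels. *)
  apply (Cmult_eq_reg_r (qpoch_inf q q)); [| exact Hq].
  transitivity (qpoch_inf q q * 1 * 1 * 1 * 1 * 1 * bisum a 0 0 0 0); [ring |].
  rewrite <- E; unfold Cdiv; ring.
Qed.

End FixedBase.

End NonzeroBase.

(** * The series with parameters [1 / u_i] *)

Lemma Cpowz_of_nat (x : C) (n : nat) : Cpowz x (Z.of_nat n) = x ^ n.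
Proof.
  destruct n as [|n]; [easy |].
  simpl Z.of_nat; unfold Cpowz; now rewrite SuccNat2Pos.id_succ.
Qed.

Lemma Cpowz_neg (x : C) (n : nat) : Cpowz x (- Z.of_nat (S n)) = / x ^ S n.
Proof.
  simpl Z.of_nat; simpl Z.opp; unfold Cpowz; now rewrite SuccNat2Pos.id_succ.
Qed.

Section NonzeroBase.

Variable q : C.
Hypothesis hq0 : q <> 0.
Hypothesis hq1 : (Cmod q < 1)%R.

(** Both cases of [qpoch] agree: a nonzero tail cancels by [qpoch_inf_split], a vanishing one leaves
    the finite product by definition. *)
Lemma qpoch_of_nat (x : C) (n : nat) : qpoch q x (Z.of_nat n) = qprod q x n.
Proof.
  unfold qpoch; rewrite Cpowz_of_nat.
  destruct (Ceq_dec (qpoch_inf q (x * q ^ n)) 0) as [_ | Hn].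
  - destruct n as [|n]; [easy |].
    simpl Z.of_nat; cbv iota beta; now rewrite SuccNat2Pos.id_succ.
  - rewrite (qpoch_inf_split q hq0 hq1 x n); field; exact Hn.
Qed.

Lemma qpoch_neg (x : C) (n : nat) :
  qpoch q x (- Z.of_nat (S n)) = / qprod q (x / q ^ S n) (S n).
Proof.
  unfold qpoch; rewrite Cpowz_neg; fold (x / q ^ S n).
  destruct (Ceq_dec (qpoch_inf q (x / q ^ S n)) 0) as [_ | Hn].
  - simpl Z.of_nat; simpl Z.opp; cbv iota beta.
    now rewrite SuccNat2Pos.id_succ.
  - assert (E := qpoch_inf_split q hq0 hq1 (x / q ^ S n) (S n)).
    replace (x / q ^ S n * q ^ S n) with x in E by (field; now apply Cpow_nz).
    assert (Hx : qpoch_inf q x <> 0) by (intros H; apply Hn; rewrite E, H; ring).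
    assert (Hp : qprod q (x / q ^ S n) (S n) <> 0)
      by (intros H; apply Hn; rewrite E, H; ring).
    rewrite E; field; auto.
Qed.

Lemma qpoch_ratio_nat (z x : C) (n : nat) : x <> 0 ->
  qpoch_inf q (z * q / x) <> 0 ->
  qpoch q x (Z.of_nat n) / qpoch q (z * q / x) (Z.of_nat n)
  = x ^ n * hprod q z (/ x) n.
Proof.
  intros Hx Hz; rewrite !qpoch_of_nat.
  apply (Cmult_eq_reg_r (qprod q (z * q / x) n)); [| now apply qprod_neq_0].
  unfold Cdiv at 1; rewrite <- Cmult_assoc, Cinv_l, Cmult_1_r
    by now apply qprod_neq_0.
  induction n as [|n IH]; [simpl; ring |].
  simpl qprod; rewrite IH; simpl.
  assert (Hn := qfactor_neq_0 q hq0 hq1 _ n Hz).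
  change (z * q / x) with (z * q * / x) in *.
  set (w := 1 - z * q * / x * q ^ n) in *.
  field; split; assumption.
Qed.

Lemma qprod_backward_S (x : C) (n : nat) :
  qprod q (x / q ^ S n) (S n) = (1 - x / q ^ S n) * qprod q (x / q ^ n) n.
Proof.
  rewrite qprod_S_l; do 2 f_equal.
  rewrite Cpow_S; field; split; [now apply Cpow_nz | exact hq0].
Qed.

Lemma qprod_backward_neq_0 (x : C) (n : nat) : x <> 0 ->
  qpoch_inf q (q / x) <> 0 -> qprod q (x / q ^ n) n <> 0.
Proof.
  intros Hx Hq; induction n as [|n IH]; [simpl; apply C1_nz |].
  rewrite qprod_backward_S; apply Cmult_neq_0; [| exact IH].
  intros E; apply (qfactor_neq_0 q hq0 hq1 _ n Hq).
  replace (1 - q / x * q ^ n) with (- (q * q ^ n / x) * (1 - x / q ^ S n)).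
  - rewrite E; ring.
  - rewrite Cpow_S; field; repeat split; auto; now apply Cpow_nz.
Qed.

(** Reversing the sign of the index turns base [z] and parameter [x] into base [/ z] and parameter
    [x / z], that is [u = z / x]. *)
Lemma qpoch_ratio_neg (z x : C) (n : nat) : x <> 0 -> z <> 0 ->
  qpoch_inf q (q / x) <> 0 ->
  qpoch q x (- Z.of_nat (S n)) / qpoch q (z * q / x) (- Z.of_nat (S n))
  = (q * / x) ^ S n * hprod q (/ z) (z * / x) (S n).
Proof.
  intros Hx Hz Hq; rewrite !qpoch_neg.
  assert (H : forall k, qprod q (z * q / x / q ^ k) k
    = (q * / x) ^ k * hprod q (/ z) (z * / x) k * qprod q (x / q ^ k) k).
  { induction k as [|k IH]; [simpl; ring |].
    rewrite !qprod_backward_S, IH.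
    assert (Hk := qfactor_neq_0 q hq0 hq1 _ k Hq).
    assert (Hqk := Cpow_nz _ k hq0).
    assert (E : 1 - z * q / x / q ^ S k = q * / x
      * ((z * / x - q ^ k) * / (1 - / z * q * (z * / x) * q ^ k))
      * (1 - x / q ^ S k)).
    { replace (/ z * q * (z * / x) * q ^ k) with (q / x * q ^ k)
        by (field; auto).
      assert (Hk' : x - q * q ^ k <> 0).
      { intros E0; apply Hk; replace (1 - q / x * q ^ k)
          with ((x - q * q ^ k) / x) by (field; exact Hx).
        rewrite E0; unfold Cdiv; ring. }
      rewrite Cpow_S; field; auto. }
    rewrite E; simpl; ring. }
  assert (Hd := qprod_backward_neq_0 x (S n) Hx Hq).
  unfold Cdiv at 1; rewrite (H (S n)).
  set (r := (q * / x) ^ S n * hprod q (/ z) (z * / x) (S n)).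
  set (d := qprod q (x / q ^ S n) (S n)) in *.
  (* If [r = 0], the denominator [(zq/x;q)_(-n-1)] has a pole. It is read as [/ 0 = 0], and
     inverting it again gives 0, the correct value of the ratio. *)
  destruct (Ceq_dec r 0) as [-> | Hr].
  - rewrite Cmult_0_l, !Cinv_0; ring.
  - field; auto.
Qed.

Section Term.

Variables z x1 x2 x3 x4 : C.
Hypothesis hz0 : z <> 0.
Hypothesis hz1 : 1 - z <> 0.
Hypothesis hx1 : x1 <> 0.
Hypothesis hx2 : x2 <> 0.
Hypothesis hx3 : x3 <> 0.
Hypothesis hx4 : x4 <> 0.
Hypothesis hr1 : regular q z (/ x1).
Hypothesis hr2 : regular q z (/ x2).
Hypothesis hr3 : regular q z (/ x3).
Hypothesis hr4 : regular q z (/ x4).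

Let t : C := q * (z * z) * (/ x1 * / x2 * / x3 * / x4).

Hypothesis ht : (Cmod t < 1)%R.

Lemma vwp_term_of_nat (n : nat) :
  vwp_term q z [x1; x2; x3; x4] t (Z.of_nat n)
  = vwp_half q z (/ x1) (/ x2) (/ x3) (/ x4) n.
Proof.
  unfold vwp_term; simpl map; unfold Cprod; simpl fold_right.
  rewrite !qpoch_ratio_nat by (auto; now apply proj1 in hr1, hr2, hr3, hr4).
  replace (2 * Z.of_nat n)%Z with (Z.of_nat (n + n)) by lia.
  rewrite !Cpowz_of_nat, Cpow_add_r; unfold vwp_half, t.
  rewrite !Cpow_mult_l, !Cpow_inv by assumption.
  field; repeat split; auto; now apply Cpow_nz.
Qed.

(** Powers with [m = n + 1]: the four ratios give [q^(4m)], [t^(-m)] gives [q^(-m) z^(-2m)], and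
    [(1 - z q^(-2m)) / (1 - z)] is [q^(-2m)] times [(1 - q^(2m)/z) / (1 - 1/z)]. Together they form
    [(q / z^2)^m], as base [/ z] requires. *)
Lemma vwp_term_neg (n : nat) :
  vwp_term q z [x1; x2; x3; x4] t (- Z.of_nat (S n))
  = vwp_half q (/ z) (z * / x1) (z * / x2) (z * / x3) (z * / x4) (S n).
Proof.
  unfold vwp_term; simpl map; unfold Cprod; simpl fold_right.
  change (Z.neg (Pos.of_succ_nat n)) with (- Z.of_nat (S n))%Z.
  rewrite !qpoch_ratio_neg by (auto; now apply proj2 in hr1, hr2, hr3, hr4).
  replace (2 * - Z.of_nat (S n))%Z with (- Z.of_nat (S (n + S n)))%Z by lia.
  rewrite !Cpowz_neg; replace (S (n + S n)) with (S n + S n)%nat by lia.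
  set (m := S n); rewrite Cpow_add_r; unfold vwp_half, t.
  rewrite !Cpow_mult_l, !Cpow_inv by assumption.
  assert (hz1' : z - 1 <> 0).
  { intros E; apply hz1; replace (1 - z) with (- (z - 1)) by ring.
    rewrite E; ring. }
  field; repeat split; auto; now apply Cpow_nz.
Qed.

Lemma psi66_bisum :
  is_psi66 q z x1 x2 x3 x4 t (bisum q z (/ x1) (/ x2) (/ x3) (/ x4)).
Proof.
  assert (hi := one_minus_inv z hz0 hz1).
  (* Negative indices start at [-1], so the second half loses its initial term 1. *)
  exists (cseries (vwp_half q z (/ x1) (/ x2) (/ x3) (/ x4))),
    (cseries (vwp_half q (/ z) (z * / x1) (z * / x2) (z * / x3) (z * / x4)) - 1).
  split; [| split; [| unfold bisum; ring]].
  - apply is_series_ext with (vwp_half q z (/ x1) (/ x2) (/ x3) (/ x4)).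
    + intros n; symmetry; apply vwp_term_of_nat.
    + apply vwp_half_series; try assumption; now apply proj1 in hr1, hr2, hr3, hr4.
  - apply is_series_ext with (fun n =>
      vwp_half q (/ z) (z * / x1) (z * / x2) (z * / x3) (z * / x4) (S n)).
    + intros n; symmetry; apply vwp_term_neg.
    + set (f := vwp_half q (/ z) (z * / x1) (z * / x2) (z * / x3) (z * / x4)).
      apply is_cseries_clim, clim_ext with (fun n => csum f (S n) - 1).
      * assert (f0 : f 0%nat = 1).
        { rewrite <- (Cinv_r _ hi); unfold f, vwp_half; simpl; ring. }
        induction n as [|n IH].
        { rewrite csum_S, !csum_O, f0; ring. }
        { rewrite (csum_S (fun n => f (S n))), <- IH, (csum_S f (S n)); ring. }
      * apply clim_minus; [| apply clim_const].
        apply (clim_subseq (csum f)); [intros; lia |].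
        apply is_cseries_clim; unfold f; apply vwp_half_series; auto;
          try (apply regular_inv; assumption).
        rewrite argument_inv; assumption.
Qed.

End Term.

End NonzeroBase.

(** * Specialization to the stated parameters *)

Lemma Cmult_nz_l (x y : C) : x * y <> 0 -> x <> 0.
Proof. intros H E; apply H; rewrite E; ring. Qed.

Lemma Cmult_nz_r (x y : C) : x * y <> 0 -> y <> 0.
Proof. intros H E; apply H; rewrite E; ring. Qed.

(* The last two hypotheses say that no denominator vanishes.  They cover the
   terms of the series too: (x;q)_n, for x one of the four parameters, is
   finite for n < 0 because (q/x;q)_oo <> 0, and (z q/x;q)_n is nonzero for
   n >= 0 because (z q/x;q)_oo <> 0.  For n < 0, (z q/x;q)_n may have a pole;
   its inverse is then 0, in accordance with / 0 = 0. *)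
Theorem corollary4p1 (q a b c d e f g z : C)
  (hq0 : (0 < Cmod q)%R) (hq1 : (Cmod q < 1)%R)
  (ha0 : a <> 0) (hb0 : b <> 0) (hc0 : c <> 0) (hd0 : d <> 0)
  (he0 : e <> 0) (hf0 : f <> 0) (hg0 : g <> 0)
  (ha : a = b * c) (hz : z = d * e / q)
  (hconv : (Cmod (a * q / (f * g)) < 1)%R)
  (hz1 : 1 - z <> 0)
  (hden : qpochs_inf q [q / b; q / c; a * q / f; a * q / g; d * e / b; d * e / c;
            a * q / (f * g); a * q ^ 2 / (d * e * f); a * q ^ 2 / (d * e * g)] <> 0) :
  is_psi66 q z b c (f * z / a) (g * z / a) (a * q / (f * g))
    (qpochs_inf q [q; d * e; q ^ 2 / (d * e); d * e / (b * c);
       c * q / f; c * q / g; b * q / f; b * q / g;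
       (b * c * q) ^ 2 / (d * e * f * g)]
     / qpochs_inf q [q / b; q / c; a * q / f; a * q / g; d * e / b; d * e / c;
       a * q / (f * g); a * q ^ 2 / (d * e * f); a * q ^ 2 / (d * e * g)]).
Proof.
  apply Cmod_gt_0 in hq0.
  assert (hz0 : z <> 0).
  { rewrite hz; unfold Cdiv; auto using Cmult_neq_0, Cinv_neq_0. }
  (* For the parameters [x_i], namely [b, c, f z / a, g z / a], the [A] equations rewrite
     [z q / x_i], the [B] equations [q / x_i] and the [P] equations [z q / (x_i x_j)]: the arguments
     in [bisum_reduce_all]. *)
  assert (A1 : z * q * / b = d * e / b) by (rewrite hz; field; auto).
  assert (A2 : z * q * / c = d * e / c) by (rewrite hz; field; auto).
  assert (A3 : z * q * / (f * z / a) = a * q / f) by (field; auto).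
  assert (A4 : z * q * / (g * z / a) = a * q / g) by (field; auto).
  assert (B3 : q * / (f * z / a) = a * q ^ 2 / (d * e * f))
    by (rewrite hz; field; auto).
  assert (B4 : q * / (g * z / a) = a * q ^ 2 / (d * e * g))
    by (rewrite hz; field; auto).
  (* Here [a = b c] turns the argument [q z^2 / (x_1 x_2 x_3 x_4)] into [a q / (f g)]. *)
  assert (T : q * (z * z) * (/ b * / c * / (f * z / a) * / (g * z / a))
              = a * q / (f * g)) by (rewrite ha; field; auto).
  assert (P12 : z * q * (/ b * / c) = d * e / (b * c)) by (rewrite hz; field; auto).
  assert (P13 : z * q * (/ b * / (f * z / a)) = c * q / f)
    by (rewrite ha; field; auto).
  assert (P14 : z * q * (/ b * / (g * z / a)) = c * q / g)
    by (rewrite ha; field; auto).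
  assert (P23 : z * q * (/ c * / (f * z / a)) = b * q / f)
    by (rewrite ha; field; auto).
  assert (P24 : z * q * (/ c * / (g * z / a)) = b * q / g)
    by (rewrite ha; field; auto).
  assert (P34 : z * q * (/ (f * z / a) * / (g * z / a))
              = (b * c * q) ^ 2 / (d * e * f * g))
    by (rewrite ha, hz; field; auto 10).
  assert (Z1 : z * q = d * e) by (rewrite hz; field; auto).
  assert (Z2 : q / z = q ^ 2 / (d * e)) by (rewrite hz; field; auto).
  assert (hx3 : f * z / a <> 0)
    by (unfold Cdiv; auto using Cmult_neq_0, Cinv_neq_0).
  assert (hx4 : g * z / a <> 0)
    by (unfold Cdiv; auto using Cmult_neq_0, Cinv_neq_0).
  unfold qpochs_inf, Cprod in *; cbn [map fold_right] in *.
  assert (D1 := Cmult_nz_l _ _ hden); assert (R1 := Cmult_nz_r _ _ hden).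
  assert (D2 := Cmult_nz_l _ _ R1); assert (R2 := Cmult_nz_r _ _ R1).
  assert (D3 := Cmult_nz_l _ _ R2); assert (R3 := Cmult_nz_r _ _ R2).
  assert (D4 := Cmult_nz_l _ _ R3); assert (R4 := Cmult_nz_r _ _ R3).
  assert (D5 := Cmult_nz_l _ _ R4); assert (R5 := Cmult_nz_r _ _ R4).
  assert (D6 := Cmult_nz_l _ _ R5); assert (R6 := Cmult_nz_r _ _ R5).
  assert (R7 := Cmult_nz_r _ _ R6).
  assert (D8 := Cmult_nz_l _ _ R7); assert (R8 := Cmult_nz_r _ _ R7).
  assert (D9 := Cmult_nz_l _ _ R8).
  clear R1 R2 R3 R4 R5 R6 R7 R8.
  assert (hr1 : regular q z (/ b)) by (split; [now rewrite A1 | exact D1]).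
  assert (hr2 : regular q z (/ c)) by (split; [now rewrite A2 | exact D2]).
  assert (hr3 : regular q z (/ (f * z / a)))
    by (split; [now rewrite A3 | now rewrite B3]).
  assert (hr4 : regular q z (/ (g * z / a)))
    by (split; [now rewrite A4 | now rewrite B4]).
  rewrite <- T in hconv.
  assert (E := bisum_reduce_all q hq0 hq1 z hz0 hz1 _ _ _ _ hr1 hr2 hr3 hr4 hconv).
  assert (S := psi66_bisum q hq0 hq1 z b c (f * z / a) (g * z / a) hz0 hz1
    hb0 hc0 hx3 hx4 hr1 hr2 hr3 hr4 hconv).
  rewrite (bisum_no_parameter q hq0 hq1 z hz0 hz1) in E.
  rewrite P12, P13, P14, P23, P24, P34, A1, A2, A3, A4, B3, B4, T, Z1, Z2 in E.
  rewrite T in S.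
  (* [E] is the claim cleared of denominators: nine products times the sum on the left, six pair
     products and the three from [bisum_no_parameter] on the right. *)
  match goal with |- is_psi66 _ _ _ _ _ _ _ (?N / ?D) =>
    replace (N / D) with (bisum q z (/ b) (/ c) (/ (f * z / a)) (/ (g * z / a)));
      [exact S |];
    apply (Cmult_eq_reg_r D); [| exact hden];
    change (N / D) with (N * / D);
    rewrite <- (Cmult_assoc N), Cinv_l, Cmult_1_r by exact hden
  end.
  fold (q / b) (q / c) in E.
  match type of E with _ = ?M => transitivity M; [rewrite <- E |] end; ring.
Qed.
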